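(* Let $M$ be a connected topological manifold of dimension at least $2$ with an effective action of a finite group $G$, let $n\ge 2$, and let ${\bf x}=(x_1,\dots,x_n)\in F_G(M,n)$ be a base point such that every orbit $G(x_i)$ is of free type. Then the following five sequences, whose injections are the inclusions of subgroups, are short exact: $$1\to\mathcal{P}_n(M,G)\to\mathcal{B}_n^{orb}(M,G)\xrightarrow{\ \Phi\ }G^{\times n}\rtimes_\varphi\Sigma_n\to1,$$ $$1\to\mathcal{P}_n^{orb}(M,G)\to\mathcal{B}_n^{orb}(M,G)\xrightarrow{\ p_\Sigma\circ\Phi\ }\Sigma_n\to1,$$ $$1\to\mathcal{B}_n(M,G)\to\mathcal{B}_n^{orb}(M,G)\xrightarrow{\ p_G\circ\Phi\ }G^{\times n}\to1,$$ $$1\to\mathcal{P}_n(M,G)\to\mathcal{P}_n^{orb}(M,G)\xrightarrow{\ \Phi_G\ }G^{\times n}\to1,$$ $$1\to\mathcal{P}_n(M,G)\to\mathcal{B}_n(M,G)\xrightarrow{\ \Phi_\Sigma\ }\Sigma_n\to1.$$ Here the third sequence is exact in the sense of maps (the map $p_G\circ\Phi$ is surjective and the preimage of the unit element is $\mathcal{B}_n(M,G)$; it need not be a group homomorphism), while the other four are exact sequences of group homomorphisms. Moreover all these maps fit together in one commutative diagram: the inclusions $\mathcal{P}_n(M,G)\subset\mathcal{P}_n^{orb}(M,G)\subset\mathcal{B}_n^{orb}(M,G)$ and $\mathcal{P}_n(M,G)\subset\mathcal{B}_n(M,G)\subset\mathcal{B}_n^{orb}(M,G)$ are compatible, $p_G\circ\Phi$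 restricted to $\mathcal{P}_n^{orb}(M,G)$ equals $\Phi_G$, and $p_\Sigma\circ\Phi$ restricted to $\mathcal{B}_n(M,G)$ equals $\Phi_\Sigma$.
   Context: Orbit configuration space: $F_G(M,n)=\{(y_1,\dots,y_n)\in M^{\times n}\mid G(y_i)\cap G(y_j)=\emptyset \text{ for } i\neq j\}$ with the subspace topology. $G^{\times n}$ acts coordinatewise on $F_G(M,n)$. For an $n$-tuple $y$ (of points, of paths or of group elements) and $\sigma\in\Sigma_n$ put $y_\sigma=(y_{\sigma(1)},\dots,y_{\sigma(n)})$. Products in $\Sigma_n$ are taken so that $(\sigma\tau)(i)=\tau(\sigma(i))$, i.e. $(y_\tau)_\sigma=y_{\sigma\tau}$. An orbit $G(y)$ is of free type if the isotropy group of $y$ is trivial. Orbit braids: $I=[0,1]$ carries the trivial $G$-action. A path $\alpha=(\alpha_1,\dots,\alpha_n):I\to F_G(M,n)$ determines the unordered collection of strings $c(\alpha)=\{c(\alpha_1),\dots,c(\alpha_n)\}$ in $M\times I$, $c(\alpha_i)=\{(\alpha_i(s),s)\mid s\in I\}$, and the unordered collection $\widetilde{c(\alpha)}=\{\widetilde{c(\alpha_1)},\dots,\widetilde{c(\alpha_n)}\}$, where $\widetilde{c(\alpha_i)}=\{h\,c(\alpha_i)\mid h\in G\}$ is a collection of strings. If $\alpha(0)={\bf x}$ and $\alpha(1)=g{\bf x}_\sigma$ with $(g,\sigma)\in G^{\times n}\times\Sigma_n$ (such a pair is unique), $\widetilde{c(\alpha)}$ is an orbit braid. Two orbit braids are equivalent,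 $\widetilde{c(\alpha)}\sim\widetilde{c(\beta)}$, if for some $g,h\in G^{\times n}$ the paths $g\alpha,h\beta$ have the same endpoints and $c(g\alpha)\sim_{iso}^Gc(h\beta)$, i.e. there are continuous maps $\widehat F_i:I\times I\to M\times I$, $\widehat F_i(s,t)=(F_i(s,t),s)$, $i=1,\dots,n$, deforming $c(g\alpha)$ (at $t=0$) into $c(h\beta)$ (at $t=1$), keeping the unordered sets of endpoints at $s=0$ and $s=1$ fixed, with $G(F_i(s,t))\cap G(F_j(s,t))=\emptyset$ for all $(s,t)$ and $i\neq j$. $\mathcal{B}_n^{orb}(M,G)$ (the orbit braid group) is the set of equivalence classes of orbit braids with the product $[\widetilde{c(\alpha)}]*[\widetilde{c(\beta)}]=[\widetilde{c(\alpha\circ(g\beta_\sigma))}]$, where $\alpha(0)=\beta(0)={\bf x}$, $\alpha(1)=g{\bf x}_\sigma$ and $\circ$ is concatenation of paths. Subgroups: $\mathcal{P}_n^{orb}(M,G)$, $\mathcal{B}_n(M,G)$, $\mathcal{P}_n(M,G)$ consist of the classes $[\widetilde{c(\alpha)}]$ with $\alpha(0)={\bf x}$ and, respectively, $\alpha(1)\in G^{\times n}({\bf x})$, $\alpha(1)\in\{{\bf x}_\sigma\mid\sigma\in\Sigma_n\}$, $\alpha(1)={\bf x}$. Maps: $\varphi:\Sigma_n\to\mathrm{Aut}(G^{\times n})$, $\varphi(\sigma)(g)=g_\sigma$; $G^{\times n}\rtimes_\varphi\Sigma_n$ has product $(g,\sigma)\cdot(h,\tau)=(gh_\sigma,\sigma\tau)$.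 $\Phi([\widetilde{c(\alpha)}])=(g,\sigma)$, where $\alpha(0)={\bf x}$, $\alpha(1)=g{\bf x}_\sigma$. $p_G:G^{\times n}\rtimes_\varphi\Sigma_n\to G^{\times n}$ and $p_\Sigma:G^{\times n}\rtimes_\varphi\Sigma_n\to\Sigma_n$ are the projections $(g,\sigma)\mapsto g$ and $(g,\sigma)\mapsto\sigma$. $\Phi_G:\mathcal{P}_n^{orb}(M,G)\to G^{\times n}$ is $[\widetilde{c(\alpha)}]\mapsto g$ and $\Phi_\Sigma:\mathcal{B}_n(M,G)\to\Sigma_n$ is $[\widetilde{c(\alpha)}]\mapsto\sigma$. *)

(* Defs.v *)
From HB Require Import structures.
From mathcomp Require Import all_boot all_order all_algebra all_fingroup.
From mathcomp Require Import generic_quotient.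
From mathcomp Require Import mathcomp_extra boolp classical_sets functions cardinality.
From mathcomp Require Import reals topology normedtype.
From mathcomp Require Import lra.

Set Implicit Arguments.
Unset Strict Implicit.
Unset Printing Implicit Defensive.

Import Order.TTheory GRing.Theory Num.Theory.
Import numFieldNormedType.Exports.

Local Open Scope classical_set_scope.
Local Open Scope ring_scope.

(* Manifolds are without boundary; d is the dimension. *)
Definition locally_euclidean (R : realType) (d : nat) (M : topologicalType) :=
  forall p : M, exists (U : set M) (V : set 'rV[R]_d)
      (f : M -> 'rV[R]_d) (g : 'rV[R]_d -> M),
    [/\ open U, U p & open V] /\
    [/\ f @` U = V, {in U, cancel f g},
        {within U, continuous f} & {within V, continuous g}].

Record topological_manifold (R : realType) (d : nat) (M : topologicalType) :
    Prop := TopologicalManifold {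
  manifold_hausdorff : hausdorff_space M;
  manifold_second_countable : @second_countable M;
  manifold_locally_euclidean : locally_euclidean R d M }.

(* Left actions by homeomorphisms (continuity of each A g suffices since the
   group is finite, i.e. discrete). *)
Record gaction (G : finGroupType) (M : topologicalType) := GAction {
  gact :> G -> M -> M;
  gact1 : forall p, gact 1%g p = p;
  gactM : forall g h p, gact (g * h)%g p = gact g (gact h p);
  gact_continuous : forall g, continuous (gact g) }.

Section Action.
Context (G : finGroupType) (M : topologicalType) (A : gaction G M).

Definition effective := forall g : G, (forall p, A g p = p) -> g = 1%g.
Definition gorbit (p : M) : set M := [set A g p | g in [set: G]].
Definition isotropy (p : M) : set G := [set g | A g p = p].
Definition free_type (p : M) := isotropy p = [set 1%g].

End Action.

Section Tuples.
Context (n : nat).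

Definition permute (T : Type) (y : 'I_n -> T) (s : 'S_n) : 'I_n -> T :=
  fun i => y (s i).

Context (G : finGroupType).

Definition permute_ffun (s : 'S_n) (g : {ffun 'I_n -> G}) : {ffun 'I_n -> G} :=
  [ffun i => g (s i)].

Context (M : topologicalType) (A : gaction G M).

Definition tact (g : {ffun 'I_n -> G}) (y : 'I_n -> M) : 'I_n -> M :=
  fun i => A (g i) (y i).

Definition orbit_conf : set ('I_n -> M) :=
  [set y | forall i j, i != j -> gorbit A (y i) `&` gorbit A (y j) = set0].

End Tuples.

Section SemidirectProduct.
Context (G : finGroupType) (n : nat).

(* The product (g, s) (h, t) = (g h_s, s t).  The product of 'S_n is
   (s * t) i = t (s i), so that (y_t)_s = y_(s * t). *)
Definition semidirect : Type := ({ffun 'I_n -> G} * 'S_n)%type.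
HB.instance Definition _ :=
  Choice.copy semidirect ({ffun 'I_n -> G} * 'S_n)%type.

Definition semidirect_mul (u v : semidirect) : semidirect :=
  ((u.1 * permute_ffun u.2 v.1)%g, (u.2 * v.2)%g).
Definition semidirect_one : semidirect := (1%g, 1%g).
Definition semidirect_inv (u : semidirect) : semidirect :=
  (permute_ffun u.2^-1%g u.1^-1%g, u.2^-1%g).

Lemma ffun_mulE (g h : {ffun 'I_n -> G}) i : (g * h)%g i = (g i * h i)%g.
Proof. by rewrite ffunE. Qed.
Lemma ffun_invE (g : {ffun 'I_n -> G}) i : (g^-1)%g i = (g i)^-1%g.
Proof. by rewrite ffunE. Qed.
Lemma ffun_oneE i : (1%g : {ffun 'I_n -> G}) i = 1%g.
Proof. by rewrite ffunE. Qed.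

Lemma semidirect_mulA : associative semidirect_mul.
Proof.
move=> [g s] [h t] [k r]; congr pair => /=; last by rewrite mulgA.
by apply/ffunP => i; rewrite !(ffun_mulE, ffunE) permM mulgA.
Qed.
Lemma semidirect_mul1 : left_id semidirect_one semidirect_mul.
Proof.
move=> [g s]; congr pair => /=; last by rewrite mul1g.
by apply/ffunP => i; rewrite !(ffun_mulE, ffunE) perm1 mul1g.
Qed.
Lemma semidirect_mulg1 : right_id semidirect_one semidirect_mul.
Proof.
move=> [g s]; congr pair => /=; last by rewrite mulg1.
by apply/ffunP => i; rewrite !(ffun_mulE, ffunE) mulg1.
Qed.
Lemma semidirect_mulV : left_inverse semidirect_one semidirect_inv semidirect_mul.
Proof.
move=> [g s]; congr pair => /=; last by rewrite mulVg.
by apply/ffunP => i; rewrite !(ffun_mulE, ffun_invE, ffunE) mulVg.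
Qed.
Lemma semidirect_mulgV : right_inverse semidirect_one semidirect_inv semidirect_mul.
Proof.
move=> [g s]; congr pair => /=; last by rewrite mulgV.
apply/ffunP => i; rewrite !(ffun_mulE, ffun_invE, ffunE) /=.
by rewrite permK mulgV.
Qed.

HB.instance Definition _ := isGroup.Build semidirect semidirect_mulA
  semidirect_mul1 semidirect_mulg1 semidirect_mulV semidirect_mulgV.

End SemidirectProduct.

Definition p_G (G : finGroupType) (n : nat) (u : semidirect G n) :
  {ffun 'I_n -> G} := u.1.
Definition p_Sigma (G : finGroupType) (n : nat) (u : semidirect G n) : 'S_n :=
  u.2.

(* For u = (g, s), twist A u y is g y_s. *)
Definition twist (G : finGroupType) (M : topologicalType) (A : gaction G M)
    (n : nat) (u : semidirect G n) (y : 'I_n -> M) : 'I_n -> M :=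
  tact A u.1 (permute y u.2).

Section Within.
Context {R : realType}.

Lemma within_comp (T U V : topologicalType) (D : set T) (E : set U)
    (u : T -> U) (f : U -> V) :
  {within D, continuous u} -> (forall q, D q -> E (u q)) ->
  {within E, continuous f} -> {within D, continuous (f \o u)}.
Proof.
move=> /subspace_continuousP cu uDE /subspace_continuousP cf.
apply/subspace_continuousP => x Dx W /= nW.
have := cf _ (uDE _ Dx) W nW; rewrite /= /nbhs /= /within /= => h.
have := cu _ Dx _ h; rewrite /= /nbhs /= /within /=.
apply: filterS => y hy Dy; exact: hy Dy (uDE _ Dy).
Qed.

Lemma within_pair (T U V : topologicalType) (D : set T)
    (f : T -> U) (g : T -> V) :
  {within D, continuous f} -> {within D, continuous g} ->
  {within D, continuous (fun q => (f q, g q))}.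
Proof.
move=> cf cg x; apply: cvg_pair; [exact: cf|exact: cg].
Qed.

Lemma within_paste (T V : topologicalType) (D : set T) (c : R) (u : T -> R)
    (f g : T -> V) : closed D -> continuous u ->
  {within D `&` [set q | u q <= c], continuous f} ->
  {within D `&` [set q | c <= u q], continuous g} ->
  (forall q, D q -> u q = c -> f q = g q) ->
  {within D, continuous (fun q => if u q <= c then f q else g q)}.
Proof.
move=> cD cu cf cg fg.
have -> : D = (D `&` [set q | u q <= c]) `|` (D `&` [set q | c <= u q]).
  rewrite -setIUr; apply/esym/setIidPl => q _ /=.
  by case: (lerP (u q) c) => [|/ltW]; [left|right].
apply: withinU_continuous.
- apply: closedI => //.
  apply: (@preimage_closed _ _ u [set r | r <= c]); last exact: closed_le.
  by move=> ? _; exact: cu.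
- apply: closedI => //.
  apply: (@preimage_closed _ _ u [set r | c <= r]); last exact: closed_ge.
  by move=> ? _; exact: cu.
- apply: subspace_eq_continuous cf => q; rewrite inE /= => -[Dq qc].
  by rewrite /from_subspace qc.
- apply: subspace_eq_continuous cg => q; rewrite inE /= => -[Dq qc].
  by rewrite /from_subspace; case: lerP => // qc'; rewrite fg //; apply/eqP; rewrite eq_le qc' qc.
Qed.

End Within.

Lemma within_prodP (T : topologicalType) (n : nat) (M : topologicalType)
    (D : set T) (f : T -> 'I_n -> M) :
  {within D, continuous (f : T -> {ptws 'I_n -> M})} <->
  (forall i, {within D, continuous (f ^~ i)}).
Proof.
split=> [cf i|cf].
  move=> q W nW.
  exact: (cf q _ (@proj_continuous 'I_n (fun=> M) i (f q) W nW)).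
move=> q; apply/cvg_sup => i; apply/cvg_image.
  rewrite eqEsubset; split=> // v _; by exists (fun=> v).
move=> W nW; have := cf i q W nW; rewrite /= => h.
exists [set y | W (y i)].
  exact: h.
rewrite eqEsubset; split=> [v [y Wy <-] //|v Wv].
by exists (fun=> v).
Qed.

(* a map from a connected set to a finite subset of a Hausdorff space is
   constant *)
Lemma within_finite_cst (T M : topologicalType) (D : set T) (f : T -> M)
    (E : set M) (p q : T) : hausdorff_space M -> connected D ->
  {within D, continuous f} -> finite_set E -> (forall t, D t -> E (f t)) ->
  D p -> D q -> f p = f q.
Proof.
move=> hM cD cf fE DE Dp Dq.
have cfD := connected_continuous_connected cD cf.
have acc := hausdorff_accessible hM.
have ffD : finite_set (f @` D).
  apply: sub_finite_set fE => _ [t Dt <-]; exact: DE.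
have cl S : S `<=` f @` D -> closed S.
  move=> SD; apply: (proj1 (@accessible_finite_set_closed M) acc S).
  exact: sub_finite_set SD ffD.
have H : [set f p] = f @` D.
  apply: cfD.
  - by exists (f p).
  - exists (~` (f @` D `\ f p)).
      rewrite openC; apply: cl; exact: subDsetl.
    rewrite eqEsubset; split=> [y ->|y [yD /= h]].
      by split; [exists p|move=> [] _ /=; apply].
    by apply: contrapT => yp; apply: h.
  - exists [set f p]; first by apply: cl => _ ->; exists p.
    rewrite eqEsubset; split=> [y ->|y []//].
    by split => //; exists p.
have : (f @` D) (f q) by exists q.
by rewrite -H.
Qed.

Section ActionLemmas.
Context (G : finGroupType) (M : topologicalType) (A : gaction G M) (n : nat).
Implicit Types (p q : M) (y : 'I_n -> M) (g h : {ffun 'I_n -> G}) (s : 'S_n).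

Lemma gactK (g : G) : cancel (A g) (A g^-1%g).
Proof. by move=> p; rewrite -gactM mulVg gact1. Qed.

Lemma gactVK (g : G) : cancel (A g^-1%g) (A g).
Proof. by move=> p; rewrite -gactM mulgV gact1. Qed.

Lemma disjointP p q :
  gorbit A p `&` gorbit A q = set0 <-> (forall g : G, p <> A g q).
Proof.
split=> [H g pq|H].
  suff : (gorbit A p `&` gorbit A q) p by rewrite H.
  by split; [exists 1%g; rewrite ?gact1|exists g].
rewrite -subset0 => _ [[g _ <-] [h _ hg]].
by apply: (H (g^-1 * h)%g); rewrite gactM hg gactK.
Qed.

Lemma disjoint_act (g h : G) p q : gorbit A p `&` gorbit A q = set0 ->
  gorbit A (A g p) `&` gorbit A (A h q) = set0.
Proof.
move=> /disjointP H; apply/disjointP => k pq; apply: (H (g^-1 * (k * h))%g).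
by rewrite !gactM -pq gactK.
Qed.

Lemma orbit_conf_act g s y : orbit_conf A y ->
  orbit_conf A (tact A g (permute y s)).
Proof.
move=> H i j ij; apply/disjoint_act/H.
by rewrite (inj_eq perm_inj).
Qed.

Lemma tactM g h y : tact A (g * h)%g y = tact A g (tact A h y).
Proof. by apply/funext => i; rewrite /tact ffun_mulE gactM. Qed.

Lemma tact1 y : tact A 1%g y = y.
Proof. by apply/funext => i; rewrite /tact ffun_oneE gact1. Qed.

Lemma permuteM s t y : permute (permute y t) s = permute y (s * t)%g.
Proof. by apply/funext => i; rewrite /permute permM. Qed.

Lemma permute1 y : permute y 1%g = y.
Proof. by apply/funext => i; rewrite /permute perm1. Qed.

Lemma permute_tact g s y :
  permute (tact A g y) s = tact A (permute_ffun s g) (permute y s).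
Proof. by apply/funext => i; rewrite /permute /tact ffunE. Qed.

Lemma twistM (u v : semidirect G n) y :
  twist A (u * v)%g y = twist A u (twist A v y).
Proof. by rewrite /twist /= permute_tact permuteM -tactM. Qed.

Lemma twist1 y : twist A 1%g y = y.
Proof. by rewrite /twist /= permute1 tact1. Qed.

End ActionLemmas.

Section Cts.
Context (R : realType) (T : topologicalType).
Implicit Types f g : T -> R.

Lemma cts_cst (c : R) : continuous (fun _ : T => c).
Proof. by move=> q; exact: cvg_cst. Qed.
Lemma ctsB f g : continuous f -> continuous g -> continuous (fun q => f q - g q).
Proof. by move=> cf cg q; exact: (continuousB (cf q) (cg q)). Qed.
Lemma ctsD f g : continuous f -> continuous g -> continuous (fun q => f q + g q).
Proof. by move=> cf cg q; exact: (continuousD (cf q) (cg q)). Qed.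
Lemma ctsM f g : continuous f -> continuous g -> continuous (fun q => f q * g q).
Proof. by move=> cf cg q; exact: (continuousM (cf q) (cg q)). Qed.
Lemma cts_min f g : continuous f -> continuous g ->
  continuous (fun q => Num.min (f q) (g q)).
Proof. by move=> cf cg q; exact: (continuous_min (cf q) (cg q)). Qed.
Lemma cts_pair (S : topologicalType) (f : T -> R) (g : T -> S) :
  continuous f -> continuous g -> continuous (fun q => (f q, g q)).
Proof. by move=> cf cg q; exact: (cvg_pair (cf q) (cg q)). Qed.
Lemma cts_fst (S : topologicalType) : continuous (fun q : R * S => q.1).
Proof. by move=> q; exact: cvg_fst. Qed.
Lemma cts_snd (S : topologicalType) : continuous (fun q : S * R => q.2).
Proof. by move=> q; exact: cvg_snd. Qed.
Lemma cts_id : continuous (fun q : R => q).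
Proof. by move=> q. Qed.
End Cts.

Ltac cts := repeat first [ exact: cts_cst | exact: cts_fst | exact: cts_snd
  | exact: cts_id | apply: cts_pair | apply: ctsB | apply: ctsD | apply: ctsM
  | apply: cts_min | assumption ].

Lemma in00 (R : realType) : 0 <= (0 : R) <= 1.
Proof. by rewrite lexx ler01. Qed.
Lemma in11 (R : realType) : 0 <= (1 : R) <= 1.
Proof. by rewrite ler01 lexx. Qed.

Lemma min_spec (R : realType) (p q : R) :
  (Num.min p q = p /\ p <= q) \/ (Num.min p q = q /\ q <= p).
Proof.
by case: (lerP p q) => [pq|/ltW qp]; [left|right].
Qed.

Ltac minlra := repeat match goal with
  | |- context [Num.min ?p ?q] =>
    move: (min_spec p q); move: (Num.min p q) => ?
  end; intros; repeat match goal with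
  | H : _ \/ _ |- _ => destruct H as [[]|[]]
  end; subst; lra.

Lemma half0 (R : realType) : ((0 : R) <= 2^-1) = true.
Proof. by apply/idP; lra. Qed.
Lemma half1 (R : realType) : ((1 : R) <= 2^-1) = false.
Proof. by apply/negbTE; rewrite -ltNge; lra. Qed.
Lemma twice1 (R : realType) : 2 * 1 - 1 = 1 :> R.
Proof. by lra. Qed.

Section Strings.
Context (R : realType) (G : finGroupType) (M : topologicalType).
Context (A : gaction G M) (n : nat).
Implicit Types (a b : R -> 'I_n -> M).

(* A path I -> F_G(M, n) is a function on R of which only the restriction to
   [0, 1] matters. *)
Definition conf_path a :=
  {within `[0, 1], continuous (a : R -> {ptws 'I_n -> M})} /\
  (forall s : R, s \in `[0, 1] -> orbit_conf A (a s)).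

Definition string (p : R -> M) : set (M * R) := [set (p s, s) | s in `[0, 1]].

(* c(alpha).  Unordered collections are sets: the strings of a path in the
   orbit configuration space are pairwise distinct. *)
Definition strings a : set (set (M * R)) :=
  [set string (a ^~ i) | i in [set: 'I_n]].

Definition gstring (h : G) (S : set (M * R)) : set (M * R) :=
  [set (A h q.1, q.2) | q in S].

Definition orbit_string (S : set (M * R)) : set (set (M * R)) :=
  [set gstring h S | h in [set: G]].

(* The collection of the orbit strings, which determines the orbit braid. *)
Definition orbit_strings a : set (set (set (M * R))) :=
  [set orbit_string (string (a ^~ i)) | i in [set: 'I_n]].

(* The isotopy relation c(alpha) ~ c(beta): the n deformed strings need not be
   numbered compatibly with alpha or beta, only the collections matter. *)
Definition strings_iso a b :=
  exists F : 'I_n -> R * R -> M,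
    [/\ forall i, {within `[0, 1] `*` `[0, 1],
          continuous (fun st : R * R => (F i st, st.1))},
        strings (fun s i => F i (s, 0)) = strings a,
        strings (fun s i => F i (s, 1)) = strings b,
        forall t : R, t \in `[0, 1] ->
          [set F i (0, t) | i in [set: 'I_n]] = [set a 0 i | i in [set: 'I_n]] /\
          [set F i (1, t) | i in [set: 'I_n]] = [set a 1 i | i in [set: 'I_n]]
      & forall s t : R, s \in `[0, 1] -> t \in `[0, 1] ->
          orbit_conf A (fun i => F i (s, t))].

(* homotopy of paths in the orbit configuration space, with fixed endpoints *)
Definition homot a b :=
  exists H : 'I_n -> R * R -> M,
    [/\ forall i, {within `[0, 1] `*` `[0, 1], continuous (H i)},
        forall s t : R, 0 <= s <= 1 -> 0 <= t <= 1 ->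
          orbit_conf A (fun i => H i (s, t)),
        forall (s : R) i, 0 <= s <= 1 -> H i (s, 0) = a s i,
        forall (s : R) i, 0 <= s <= 1 -> H i (s, 1) = b s i
      & forall (t : R) i, 0 <= t <= 1 -> H i (0, t) = a 0 i /\ H i (1, t) = a 1 i].

Definition concat a b : R -> 'I_n -> M :=
  fun s => if s <= 2^-1 then a (2 * s) else b (2 * s - 1).

Lemma stringP (p q : R -> M) : string p = string q ->
  forall s : R, 0 <= s <= 1 -> p s = q s.
Proof.
move=> pq s s01; have : string p (p s, s) by exists s => //=; rewrite in_itv.
by rewrite pq => -[t _ [<- <-]].
Qed.

Lemma string_ext (p q : R -> M) : (forall s : R, 0 <= s <= 1 -> p s = q s) ->
  string p = string q.
Proof.
move=> pq; rewrite /string eqEsubset; split=> _ [s /= s01 <-]; exists s => //=;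
 by move: s01; rewrite in_itv => /pq ->.
Qed.

Let II : set (R * R) := `[0, 1] `*` `[0, 1].

Lemma closed_II : closed II.
Proof.
apply: closedI.
  apply: (@preimage_closed _ _ (@fst R R) [set` `[0, 1]]).
    by move=> ? _; exact: cvg_fst.
  exact: itv_closed.
apply: (@preimage_closed _ _ (@snd R R) [set` `[0, 1]]).
  by move=> ? _; exact: cvg_snd.
exact: itv_closed.
Qed.

Lemma IIE s t : II (s, t) <-> (0 <= s <= 1) /\ (0 <= t <= 1).
Proof. by rewrite /II /setX /= !in_itv. Qed.

Lemma IIi (s t : R) : 0 <= s <= 1 -> 0 <= t <= 1 -> II (s, t).
Proof. by move=> ? ?; apply/IIE. Qed.

Lemma conf_pathP a : conf_path a <->
  (forall i, {within `[0, 1], continuous (a ^~ i)}) /\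
  (forall s : R, 0 <= s <= 1 -> orbit_conf A (a s)).
Proof.
rewrite /conf_path within_prodP; split=> -[ca fa]; split=> // s s01; exact: fa.
Qed.

Lemma homot_ext a b a' b' : (forall (s : R) i, 0 <= s <= 1 -> a s i = a' s i) ->
  (forall (s : R) i, 0 <= s <= 1 -> b s i = b' s i) -> homot a b -> homot a' b'.
Proof.
move=> aa bb [H [cH fH H0 H1 He]]; exists H; split=> //.
- by move=> s i s01; rewrite H0// aa.
- by move=> s i s01; rewrite H1// bb.
- by move=> t i t01; have [-> ->] := He t i t01; rewrite !aa // ?ler01 ?lexx.
Qed.

Lemma homot_sym a b : homot a b -> homot b a.
Proof.
move=> [H [cH fH H0 H1 He]].
exists (fun i (q : R * R) => H i (q.1, 1 - q.2)); split.
- move=> i; apply: (within_comp _ _ (cH i)) => [|[s t]].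
    by apply: continuous_subspaceT; cts.
  by move=> /IIE[? ?]; apply/IIE => /=; split=> //; lra.
- by move=> s t s01 t01 /=; apply: fH => //; lra.
- by move=> s i s01; rewrite subr0 H1.
- by move=> s i s01; rewrite subrr H0.
- move=> t i t01 /=; have [|-> ->] := He (1 - t) i; first lra.
  have [h0 h1] := He 1 i (in11 R).
  by rewrite -!H1 ?in00 ?in11// h0 h1.
Qed.

Lemma homot_trans a b c : homot a b -> homot b c -> homot a c.
Proof.
move=> [H [cH fH H0 H1 He]] [K [cK fK K0 K1 Ke]].
exists (fun i (q : R * R) => if q.2 <= 2^-1 then H i (q.1, 2 * q.2) else K i (q.1, 2 * q.2 - 1)).
have ab e : e = 0 \/ e = 1 -> a e = b e.
  move=> e01; apply/funext => i; have [h0 h1] := He 1 i (in11 R).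
  by case: e01 => ->; rewrite -H1 ?in00 ?in11.
split.
- move=> i; apply: within_paste; first exact: closed_II.
  + exact: cts_snd.
  + apply: (within_comp _ _ (cH i)) => [|[s t]].
      by apply: continuous_subspaceT; cts.
    move=> [/IIE[? ?] /= ?]; apply: (@IIi s (2 * t)); lra.
  + apply: (within_comp _ _ (cK i)) => [|[s t]].
      by apply: continuous_subspaceT; cts.
    move=> [/IIE[? ?] /= ?]; apply: (@IIi s (2 * t - 1)); lra.
  + move=> [s t] /IIE[s01 t01] /= ->.
    by rewrite divff ?subrr ?H1 ?K0 // pnatr_eq0.
- move=> s t s01 t01 /=; case: (lerP t 2^-1) => ht.
    by apply: fH => //; lra.
  by apply: fK => //; lra.
- move=> s i s01 /=; by rewrite half0 mulr0 H0.
- move=> s i s01 /=; by rewrite half1 twice1 K1.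
- move=> t i t01 /=; case: (lerP t 2^-1) => ht.
    by apply: He; lra.
  by rewrite !ab; [apply: Ke; lra|right|left].
Qed.

Lemma homot_concat a b a' b' : a 1 = b 0 ->
  homot a a' -> homot b b' -> homot (concat a b) (concat a' b').
Proof.
move=> ab [H [cH fH H0 H1 He]] [K [cK fK K0 K1 Ke]].
exists (fun i (q : R * R) => if q.1 <= 2^-1 then H i (2 * q.1, q.2) else K i (2 * q.1 - 1, q.2)).
split.
- move=> i; apply: within_paste; first exact: closed_II.
  + exact: cts_fst.
  + apply: (within_comp _ _ (cH i)) => [|[s t]].
      by apply: continuous_subspaceT; cts.
    move=> [/IIE[? ?] /= ?]; apply: (@IIi (2 * s) t); lra.
  + apply: (within_comp _ _ (cK i)) => [|[s t]].
      by apply: continuous_subspaceT; cts.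
    move=> [/IIE[? ?] /= ?]; apply: (@IIi (2 * s - 1) t); lra.
  + move=> [s t] /IIE[s01 t01] /= ->.
    rewrite divff ?pnatr_eq0// subrr.
    by have [_ ->] := He t i t01; have [-> _] := Ke t i t01; rewrite ab.
- move=> s t s01 t01 /=; case: (lerP s 2^-1) => ht.
    by apply: fH => //; lra.
  by apply: fK => //; lra.
- move=> s i s01 /=; rewrite /concat; case: (lerP s 2^-1) => hs.
    by rewrite H0//; lra.
  by rewrite K0//; lra.
- move=> s i s01 /=; rewrite /concat; case: (lerP s 2^-1) => hs.
    by rewrite H1//; lra.
  by rewrite K1//; lra.
- move=> t i t01 /=; rewrite /concat.
  rewrite half0 half1 mulr0 twice1.
  by split; [have [] := He t i t01|have [] := Ke t i t01].
Qed.

Lemma homot_twist (u : semidirect G n) a b : homot a b ->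
  homot (fun s => twist A u (a s)) (fun s => twist A u (b s)).
Proof.
move=> [H [cH fH H0 H1 He]].
exists (fun i (q : R * R) => A (u.1 i) (H (u.2 i) q)); split.
- move=> i q; apply: continuous_comp; [exact: cH|exact: gact_continuous].
- by move=> s t s01 t01; exact: (orbit_conf_act u.1 u.2 (fH s t s01 t01)).
- by move=> s i s01; rewrite H0.
- by move=> s i s01; rewrite H1.
- by move=> t i t01; have [-> ->] := He t (u.2 i) t01.
Qed.

Lemma homot_reparam a (f g : R -> R) : conf_path a ->
  continuous f -> continuous g ->
  (forall s : R, 0 <= s <= 1 -> 0 <= f s <= 1) ->
  (forall s : R, 0 <= s <= 1 -> 0 <= g s <= 1) ->
  f 0 = g 0 -> f 1 = g 1 -> homot (a \o f) (a \o g).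
Proof.
move=> /conf_pathP[ca fa] cf cg f01 g01 e0 e1.
have m01 s t : 0 <= s <= 1 -> 0 <= t <= 1 ->
    0 <= (1 - t) * f s + t * g s <= 1.
  by move=> /[dup] /f01 ? /g01 ? ?; nra.
exists (fun i (q : R * R) => a ((1 - q.2) * f q.1 + q.2 * g q.1) i); split.
- move=> i; apply: (within_comp (u := fun q : R * R => (1 - q.2) * f q.1 + q.2 * g q.1) _ _ (ca i)).
    have cf1 : continuous (fun q : R * R => f q.1).
      by move=> q; apply: continuous_comp; [exact: cvg_fst|exact: cf].
    have cg1 : continuous (fun q : R * R => g q.1).
      by move=> q; apply: continuous_comp; [exact: cvg_fst|exact: cg].
    by apply: continuous_subspaceT; cts.
  by move=> [s t] /IIE[s01 t01]; rewrite /= in_itv /=; exact: m01.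
- by move=> s t s01 t01; apply: fa; exact: m01.
- by move=> s i s01 /=; rewrite subr0 mul1r mul0r addr0.
- by move=> s i s01 /=; rewrite subrr mul0r mul1r add0r.
- move=> t i t01 /=; rewrite -e0 -e1 -!mulrDl.
  by rewrite subrK !mul1r.
Qed.

Lemma homot_refl a : conf_path a -> homot a a.
Proof. by move=> ca; apply: (homot_reparam (f := id) (g := id)) => //; move=> ?. Qed.

Lemma conf_path_concat a b : conf_path a -> conf_path b -> a 1 = b 0 ->
  conf_path (concat a b).
Proof.
move=> /conf_pathP[ca fa] /conf_pathP[cb fb] ab; apply/conf_pathP; split=> [i|s s01].
  rewrite (_ : _ ^~ i = fun s => if s <= 2^-1 then a (2 * s) i else b (2 * s - 1) i); last first.
    by apply/funext => s; rewrite /concat; case: ifP.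
  apply: (within_paste (u := id)); first exact: itv_closed.
  - by move=> ?.
  - apply: (@within_comp R R M _ [set` `[0, 1]] (fun s : R => 2 * s) (a ^~ i) _ _ (ca i)).
      by apply: continuous_subspaceT; cts.
    by move=> s; rewrite /= !in_itv /=; lra.
  - apply: (@within_comp R R M _ [set` `[0, 1]] (fun s : R => 2 * s - 1) (b ^~ i) _ _ (cb i)).
      by apply: continuous_subspaceT; cts.
    by move=> s; rewrite /= !in_itv /=; lra.
  - move=> s _ /= ->; by rewrite divff ?pnatr_eq0// subrr ab.
rewrite /concat; case: (lerP s 2^-1) => hs; first by apply: fa; lra.
by apply: fb; lra.
Qed.

Lemma conf_path_twist (u : semidirect G n) a : conf_path a ->
  conf_path (fun s => twist A u (a s)).
Proof.
move=> /conf_pathP[ca fa]; apply/conf_pathP; split=> [i|s s01].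
  move=> q; apply: continuous_comp; [exact: ca|exact: gact_continuous].
exact: (orbit_conf_act u.1 u.2 (fa s s01)).
Qed.

Lemma conf_path_rev a : conf_path a -> conf_path (fun s => a (1 - s)).
Proof.
move=> /conf_pathP[ca fa]; apply/conf_pathP; split=> [i|s s01].
  apply: (@within_comp R R M _ [set` `[0, 1]] (fun s : R => 1 - s) (a ^~ i) _ _ (ca i)).
    by apply: continuous_subspaceT; cts.
  by move=> s; rewrite /= !in_itv /=; lra.
by apply: fa; lra.
Qed.

Lemma conf_path_cst y : orbit_conf A y -> conf_path (fun=> y).
Proof.
by move=> fy; apply/conf_pathP; split=> // i; apply: continuous_subspaceT => ?; exact: cvg_cst.
Qed.

End Strings.

Local Open Scope quotient_scope.

Section OrbitBraidGroup.
Context (R : realType) (d : nat) (M : topologicalType).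
Context (hM : topological_manifold R d M).
Context (G : finGroupType) (A : gaction G M) (n : nat) (x : 'I_n -> M).
Context (hx : orbit_conf A x) (hfree : forall i, free_type A (x i)).

Record braid_path := BraidPath {
  bpath :> R -> 'I_n -> M;
  bpath_conf : conf_path A bpath;
  bpath0 : bpath 0 = x;
  bpath1 : exists u : semidirect G n, bpath 1 = twist A u x }.

Implicit Types (a b c : braid_path).

(* Orbit braids are literally the sets of orbit strings of the paths above. *)
Definition orbit_braids : set (set (set (set (M * R)))) :=
  [set orbit_strings A a | a in [set: braid_path]].

Definition orbit_braid : Type := {S | S \in orbit_braids}.
HB.instance Definition _ := Choice.on orbit_braid.

Definition orbit_braid_of a : orbit_braid :=
  exist _ (orbit_strings A a) (mem_set (imageP (fun a : braid_path => orbit_strings A a) I)).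

Definition orbit_braid_equiv (S T : orbit_braid) : Prop :=
  exists a b, [/\ val S = orbit_strings A a, val T = orbit_strings A b &
    exists g h : {ffun 'I_n -> G},
      [/\ tact A g (a 0) = tact A h (b 0), tact A g (a 1) = tact A h (b 1)
        & strings_iso A (fun s => tact A g (a s)) (fun s => tact A h (b s))]].

Lemma orbit_braid_ofP (S : orbit_braid) : exists a, S = orbit_braid_of a.
Proof.
case: S => S SP; have [a _ aS] := set_mem SP; exists a; exact/val_inj.
Qed.

Lemma twist_inj : injective (fun u : semidirect G n => twist A u x).
Proof.
move=> [g s] [h t] /= H.
have ghi i : A (g i) (x (s i)) = A (h i) (x (t i)).
  exact: (congr1 (fun y => y i) H).
have st i : s i = t i.
  apply/eqP; apply: contrapT => /negP /hx /disjointP st.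
  apply: (st ((g i)^-1 * h i)%g).
  by rewrite gactM -ghi gactK.
congr pair; last exact/permP.
apply/ffunP => i; have := ghi i; rewrite -st => /(congr1 (A (g i)^-1%g)).
rewrite gactK -gactM => e.
have : isotropy A (x (s i)) ((g i)^-1 * h i)%g by [].
by rewrite hfree => /= /eqP; rewrite -eq_invg_mul invgK => /eqP.
Qed.

Lemma tact_inj : injective (fun g : {ffun 'I_n -> G} => tact A g x).
Proof.
move=> g h gh; have /(_ _)/(congr1 fst)// := @twist_inj (g, 1%g) (h, 1%g).
by rewrite /twist /= permute1; apply.
Qed.

Lemma orbit_strings_inj a b : orbit_strings A a = orbit_strings A b ->
  forall (s : R) i, 0 <= s <= 1 -> a s i = b s i.
Proof.
move=> ab s i s01.
have : orbit_strings A a (orbit_string A (string (a ^~ i))) by exists i.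
rewrite ab => -[j _ ji].
have : orbit_string A (string (a ^~ i)) (string (a ^~ i)).
  exists 1%g => //; rewrite /gstring eqEsubset; split=> [_ [[p t] pt <-]|[p t] pt].
    by rewrite gact1.
  by exists (p, t) => //=; rewrite gact1.
rewrite -ji => -[h _ hij].
have key (t : R) : 0 <= t <= 1 -> a t i = A h (b t j).
  move=> t01; have : string (a ^~ i) (a t i, t) by exists t => //=; rewrite in_itv.
  by rewrite -hij => -[[p q] [r _ [<- <-]] [<- <-]].
have := key 0 (in00 R); rewrite !bpath0 => xij.
have eij : i = j.
  apply/eqP; apply: contrapT => /negP /hx /disjointP H; exact: H xij.
have : isotropy A (x i) h by rewrite /isotropy /= {2}xij eij.
by rewrite hfree => /= h1; rewrite key// h1 gact1 eij.
Qed.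

Lemma strings_iso_homot a b (g h : {ffun 'I_n -> G}) :
  tact A g (a 0) = tact A h (b 0) ->
  strings_iso A (fun s => tact A g (a s)) (fun s => tact A h (b s)) ->
  homot A a b.
Proof.
rewrite !bpath0 => /tact_inj <-{h} [F [cF F0 F1 Fe fF]].
set a' := fun s => tact A g (a s) in F0 F1 Fe; set b' := fun s => tact A g (b s) in F1.
have fF' (s t : R) : 0 <= s <= 1 -> 0 <= t <= 1 -> orbit_conf A (F^~ (s, t)).
  by move=> s01 t01; apply: fF; rewrite in_itv.
have {F0} /choice[p pE] i : exists j, forall s : R, 0 <= s <= 1 -> F i (s, 0) = a' s j.
  have : strings (fun s i => F i (s, 0)) (string (fun s => F i (s, 0))) by exists i.
  by rewrite F0 => -[j _ /stringP e]; exists j => s s01; rewrite -e.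
have {F1} /choice[r rE] i : exists j, forall s : R, 0 <= s <= 1 -> F i (s, 1) = b' s j.
  have : strings (fun s i => F i (s, 1)) (string (fun s => F i (s, 1))) by exists i.
  by rewrite F1 => -[j _ /stringP e]; exists j => s s01; rewrite -e.
have Fcst (e t : R) i : e = 0 \/ e = 1 -> 0 <= t <= 1 -> F i (e, t) = F i (e, 0).
  move=> e01 t01.
  apply: (@within_finite_cst R M [set` `[0, 1]] (fun t => F i (e, t))
    [set a' e k | k in [set: 'I_n]] t 0 (manifold_hausdorff hM)).
  - exact: segment_connected.
  - have cFi : {within `[0, 1] `*` `[0, 1], continuous (F i)}.
      move=> q W nW; apply: (cF i q (W \o fst)); exact: cvg_fst nW.
    apply: (@within_comp R (R * R)%type M _ (`[0, 1] `*` `[0, 1]) (fun t => (e, t)) (F i) _ _ cFi).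
      by apply: continuous_subspaceT; cts.
    move=> q /= ?; split => //=; rewrite in_itv /=.
    by case: e01 => ->; rewrite ?in00 ?in11.
  - exact: finite_image.
  - move=> q q01; have [E0 E1] := Fe q q01.
    case: e01 => ->; [rewrite -E0|rewrite -E1]; by exists i.
  - by rewrite /= in_itv.
  - by rewrite /= in_itv /= in00.
have conf_inj (y : 'I_n -> M) i j : orbit_conf A y -> y i = y j -> i = j.
  move=> fy yij; apply/eqP; apply: contrapT => /negP /fy /disjointP H.
  by apply: (H 1%g); rewrite gact1.
have ab0 : a' 0 = b' 0 by rewrite /a' /b' !bpath0.
have fx : orbit_conf A (a' 0).
  by rewrite /a' bpath0; have := orbit_conf_act g 1%g hx; rewrite permute1.
have pr i : p i = r i.
  apply: (conf_inj (a' 0) (p i) (r i) fx); rewrite -pE ?in00// ab0 -rE ?in00//.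
  by rewrite -(Fcst 0 1) ?in11//; left.
have pinj : injective p.
  move=> i j pij; apply: (conf_inj _ i j (fF' 0 0 (in00 R) (in00 R))).
  by rewrite /= !pE ?in00// pij.
pose P := perm pinj.
have PE i : p (P^-1%g i) = i by have := permKV P i; rewrite {1}/P permE.
exists (fun i q => A (g i)^-1%g (F (P^-1%g i) q)); split.
- move=> i q; apply: continuous_comp; last exact: gact_continuous.
  move=> W nW; apply: (cF (P^-1%g i) q (W \o fst)); exact: cvg_fst nW.
- move=> s t s01 t01.
  have := orbit_conf_act g^-1%g P^-1%g (fF' s t s01 t01).
  congr (orbit_conf A _); apply/funext => i.
  by rewrite /tact /permute ffun_invE.
- by move=> s i s01; rewrite pE// PE /a' /tact gactK.
- by move=> s i s01; rewrite rE// -pr PE /b' /tact gactK.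
- move=> t i t01; split; rewrite (Fcst _ t) ?pE ?PE ?in00 ?in11 //; try by [left|right];
    by rewrite /a' /tact gactK.
Qed.

Lemma orbit_braid_equivP a b :
  orbit_braid_equiv (orbit_braid_of a) (orbit_braid_of b) <-> homot A a b.
Proof.
split=> [[a1 [b1 [/= aa bb [g [h [gh0 gh1 iso]]]]]]|[H [cH fH H0 H1 He]]].
  apply: homot_ext (strings_iso_homot gh0 iso) => s i s01; apply/esym;
    exact: orbit_strings_inj.
exists a, b; split=> //; exists 1%g, 1%g; split.
- by rewrite !bpath0.
- rewrite !tact1; apply/funext => i; have [_ <-] := He 1 i (in11 R).
  by rewrite H1// in11.
- exists H; split.
  + move=> i; apply: within_pair; first exact: cH.
    by apply: continuous_subspaceT => q; exact: cvg_fst.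
  + apply: eq_imagel => i _; apply: string_ext => s s01.
    by rewrite H0// tact1.
  + apply: eq_imagel => i _; apply: string_ext => s s01.
    by rewrite H1// tact1.
  + move=> t /= t01; split; apply: eq_imagel => i _; rewrite tact1; by apply He.
  + by move=> s t s01 t01; apply: fH.
Qed.

Definition orbit_braid_equivb : rel orbit_braid :=
  fun S T => `[< orbit_braid_equiv S T >].

Lemma orbit_braid_equivb_refl : reflexive orbit_braid_equivb.
Proof.
move=> S; have [a ->] := orbit_braid_ofP S; apply/asboolP/orbit_braid_equivP.
exact/homot_refl/bpath_conf.
Qed.

Lemma orbit_braid_equivb_sym : symmetric orbit_braid_equivb.
Proof.
move=> S T; have [a ->] := orbit_braid_ofP S; have [b ->] := orbit_braid_ofP T.
by apply/asboolP/asboolP; rewrite !orbit_braid_equivP; exact: homot_sym.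
Qed.

Lemma orbit_braid_equivb_trans : transitive orbit_braid_equivb.
Proof.
move=> T S U; have [a ->] := orbit_braid_ofP S; have [b ->] := orbit_braid_ofP T.
have [c ->] := orbit_braid_ofP U => /asboolP/orbit_braid_equivP ab.
move=> /asboolP/orbit_braid_equivP bc; apply/asboolP/orbit_braid_equivP.
exact: homot_trans ab bc.
Qed.

(* Transitivity uses that M is Hausdorff: an isotopy moving endpoints within a
   finite set must fix them. *)
Canonical orbit_braid_equiv_rel := EquivRel orbit_braid_equivb
  orbit_braid_equivb_refl orbit_braid_equivb_sym orbit_braid_equivb_trans.

Definition orbit_braid_group : Type := {eq_quot orbit_braid_equiv_rel}.
HB.instance Definition _ := Choice.on orbit_braid_group.

Definition braid_class a : orbit_braid_group :=
  \pi_({eq_quot orbit_braid_equiv_rel}) (orbit_braid_of a).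

Lemma braid_class_surj (u : orbit_braid_group) : exists a, braid_class a = u.
Proof.
have [a ua] := orbit_braid_ofP (repr (u : {eq_quot orbit_braid_equiv_rel})).
by exists a; rewrite /braid_class -ua reprK.
Qed.

Lemma braid_classP a b : braid_class a = braid_class b <-> homot A a b.
Proof.
rewrite -orbit_braid_equivP; split=> [/eqmodP/asboolP//|ab].
exact/eqmodP/asboolP.
Qed.

Definition braid_end a : semidirect G n := projT1 (cid (bpath1 a)).

Lemma braid_endP a : a 1 = twist A (braid_end a) x.
Proof. exact: projT2 (cid (bpath1 a)). Qed.

Lemma braid_endE a u : a 1 = twist A u x -> braid_end a = u.
Proof. by rewrite braid_endP => /twist_inj. Qed.

Lemma concat0 (p q : R -> 'I_n -> M) : concat p q 0 = p 0.
Proof. by rewrite /concat half0 mulr0. Qed.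
Lemma concat1 (p q : R -> 'I_n -> M) : concat p q 1 = q 1.
Proof. by rewrite /concat half1 twice1. Qed.

Section Mul.
Variables a b : braid_path.

Definition braid_mul_fun : R -> 'I_n -> M :=
  concat a (fun s => twist A (braid_end a) (b s)).

Lemma braid_mul_conf : conf_path A braid_mul_fun.
Proof.
apply: conf_path_concat; first exact: bpath_conf.
  exact/conf_path_twist/bpath_conf.
by rewrite bpath0 braid_endP.
Qed.

Lemma braid_mul0 : braid_mul_fun 0 = x.
Proof. by rewrite /braid_mul_fun concat0 bpath0. Qed.

Lemma braid_mul1E : braid_mul_fun 1 = twist A (braid_end a * braid_end b)%g x.
Proof. by rewrite /braid_mul_fun concat1 braid_endP twistM. Qed.

Lemma braid_mul1 : exists u : semidirect G n, braid_mul_fun 1 = twist A u x.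
Proof. by eexists; exact: braid_mul1E. Qed.

Definition braid_mul : braid_path :=
  BraidPath braid_mul_conf braid_mul0 braid_mul1.

Lemma braid_end_mul : braid_end braid_mul = (braid_end a * braid_end b)%g.
Proof. exact/braid_endE/braid_mul1E. Qed.

End Mul.

Lemma braid_one1 : exists u : semidirect G n, x = twist A u x.
Proof. by exists 1%g; rewrite twist1. Qed.

Definition braid_one : braid_path :=
  @BraidPath (fun=> x) (conf_path_cst R hx) erefl braid_one1.

Lemma braid_end_one : braid_end braid_one = 1%g.
Proof. by apply: braid_endE; rewrite twist1. Qed.

Section Inv.
Variable a : braid_path.

Definition braid_inv_fun (s : R) : 'I_n -> M := twist A (braid_end a)^-1%g (a (1 - s)).

Lemma braid_inv_conf : conf_path A braid_inv_fun.
Proof.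
exact: (conf_path_twist (a := fun s => a (1 - s)) _ (conf_path_rev (bpath_conf a))).
Qed.

Lemma braid_inv0 : braid_inv_fun 0 = x.
Proof. by rewrite /braid_inv_fun subr0 braid_endP -twistM mulVg twist1. Qed.

Lemma braid_inv1E : braid_inv_fun 1 = twist A (braid_end a)^-1%g x.
Proof. by rewrite /braid_inv_fun subrr bpath0. Qed.

Lemma braid_inv1 : exists u : semidirect G n, braid_inv_fun 1 = twist A u x.
Proof. by eexists; exact: braid_inv1E. Qed.

Definition braid_inv : braid_path :=
  BraidPath braid_inv_conf braid_inv0 braid_inv1.

Lemma braid_end_inv : braid_end braid_inv = (braid_end a)^-1%g.
Proof. exact/braid_endE/braid_inv1E. Qed.

End Inv.

Definition braid_rep (u : orbit_braid_group) : braid_path :=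
  projT1 (cid (braid_class_surj u)).

Lemma braid_repK u : braid_class (braid_rep u) = u.
Proof. exact: projT2 (cid (braid_class_surj u)). Qed.

Lemma homot_end a b : homot A a b -> braid_end a = braid_end b.
Proof.
move=> [H [_ _ _ H1 He]]; apply: braid_endE; rewrite -braid_endP.
apply/funext => i; have [_ <-] := He 1 i (in11 R).
by rewrite H1// in11.
Qed.

(* [alpha] * [beta] = [alpha o (g beta_s)], where alpha(1) = g x_s; independence
   of the representatives is braid_class_mul. *)
Definition orbit_braid_mul (u v : orbit_braid_group) : orbit_braid_group :=
  braid_class (braid_mul (braid_rep u) (braid_rep v)).
Definition orbit_braid_one : orbit_braid_group := braid_class braid_one.
Definition orbit_braid_inv (u : orbit_braid_group) : orbit_braid_group :=
  braid_class (braid_inv (braid_rep u)).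

Lemma braid_class_mul a b :
  orbit_braid_mul (braid_class a) (braid_class b) = braid_class (braid_mul a b).
Proof.
have /braid_classP ha := braid_repK (braid_class a).
have /braid_classP hb := braid_repK (braid_class b).
apply/braid_classP; apply: homot_concat => //; first by rewrite bpath0 braid_endP.
by rewrite (homot_end ha); exact: homot_twist.
Qed.

Lemma orbit_braid_mulA : associative orbit_braid_mul.
Proof.
move=> u v w; rewrite -(braid_repK u) -(braid_repK v) -(braid_repK w).
move: (braid_rep u) (braid_rep v) (braid_rep w) => a b c {u v w}.
rewrite !braid_class_mul; apply/braid_classP/homot_sym.
set k := braid_mul a (braid_mul b c).
pose f (s : R) := Num.min (2 * s) (Num.min (s + 4^-1) (2^-1 * s + 2^-1)).
have H : homot A (k \o f) (k \o id).
  apply: homot_reparam; first exact: bpath_conf.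
  - by rewrite /f; cts.
  - by cts.
  - by move=> s s01; rewrite /f; minlra.
  - by [].
  - by rewrite /f; minlra.
  - by rewrite /f; minlra.
apply: homot_ext H => // s i s01 /=.
rewrite /braid_mul_fun /concat.
have -> : braid_end (braid_mul a b) = (braid_end a * braid_end b)%g.
  exact: braid_end_mul.
rewrite twistM /= /braid_mul_fun /concat.
have [s4|s4] := lerP s 4^-1.
  have -> : f s = 2 * s by rewrite /f; minlra.
  by rewrite !ifT //; lra.
have [s2|s2] := lerP s 2^-1.
  have -> : f s = s + 4^-1 by rewrite /f; minlra.
  rewrite ifF; last by apply/negbTE; rewrite -ltNge; lra.
  rewrite ifT; last by lra.
  rewrite ifF; last by apply/negbTE; rewrite -ltNge; lra.
  by congr (twist _ _ (b _) _); lra.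
have -> : f s = 2^-1 * s + 2^-1 by rewrite /f; minlra.
rewrite ifF; last by apply/negbTE; rewrite -ltNge; lra.
rewrite ifF; last by apply/negbTE; rewrite -ltNge; lra.
by congr (twist _ _ (twist _ _ (c _)) _); lra.
Qed.

Lemma orbit_braid_mul1 : left_id orbit_braid_one orbit_braid_mul.
Proof.
move=> u; rewrite -(braid_repK u); move: (braid_rep u) => a {u}.
rewrite braid_class_mul; apply/braid_classP/homot_sym.
pose f (s : R) := 0 - Num.min 0 (1 - 2 * s).
have H : homot A (a \o id) (a \o f).
  apply: homot_reparam; first exact: bpath_conf.
  - by cts.
  - by rewrite /f; cts.
  - by [].
  - by move=> s s01; rewrite /f; minlra.
  - by rewrite /f; minlra.
  - by rewrite /f; minlra.
apply: homot_ext H => // s i s01 /=.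
rewrite /braid_mul_fun /concat braid_end_one.
case: ifP => [s2|/negbT]; last rewrite -ltNge => s2.
  by have -> : f s = 0; [rewrite /f; minlra|rewrite bpath0].
by rewrite twist1; congr (a _ i); rewrite /f; minlra.
Qed.

Lemma orbit_braid_mulg1 : right_id orbit_braid_one orbit_braid_mul.
Proof.
move=> u; rewrite -(braid_repK u); move: (braid_rep u) => a {u}.
rewrite braid_class_mul; apply/braid_classP/homot_sym.
pose f (s : R) := Num.min (2 * s) 1.
have H : homot A (a \o id) (a \o f).
  apply: homot_reparam; first exact: bpath_conf.
  - by cts.
  - by rewrite /f; cts.
  - by [].
  - by move=> s s01; rewrite /f; minlra.
  - by rewrite /f; minlra.
  - by rewrite /f; minlra.
apply: homot_ext H => // s i s01 /=.
rewrite /braid_mul_fun /concat -braid_endP.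
case: ifP => [s2|/negbT]; last rewrite -ltNge => s2.
  by congr (a _ i); rewrite /f; minlra.
by congr (a _ i); rewrite /f; minlra.
Qed.

Lemma braid_class_inv a : orbit_braid_mul (braid_class (braid_inv a)) (braid_class a) =
  orbit_braid_one.
Proof.
rewrite braid_class_mul; apply/braid_classP.
pose k s := twist A (braid_end a)^-1%g (a s).
pose f (s : R) := 1 - Num.min (2 * s) (2 - 2 * s).
have H : homot A (k \o f) (k \o fun=> 1).
  apply: homot_reparam; first exact/conf_path_twist/bpath_conf.
  - by rewrite /f; cts.
  - by cts.
  - by move=> s s01; rewrite /f; minlra.
  - by move=> s _; rewrite in11.
  - by rewrite /f; minlra.
  - by rewrite /f; minlra.
apply: homot_ext H => s i s01 /=.
  rewrite /braid_mul_fun /concat braid_end_inv /= /braid_inv_fun /k.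
  case: ifP => [s2|/negbT]; last rewrite -ltNge => s2.
    by congr (twist _ _ (a _) _); rewrite /f; minlra.
  by congr (twist _ _ (a _) _); rewrite /f; minlra.
by rewrite /k braid_endP -twistM mulVg twist1.
Qed.

Lemma orbit_braid_mulV : left_inverse orbit_braid_one orbit_braid_inv orbit_braid_mul.
Proof. by move=> u; rewrite -{2}(braid_repK u) braid_class_inv. Qed.

Lemma orbit_braid_mulgV : right_inverse orbit_braid_one orbit_braid_inv orbit_braid_mul.
Proof.
move=> u; set v := orbit_braid_inv u; set w := orbit_braid_inv v.
have wv : orbit_braid_mul w v = orbit_braid_one by exact: orbit_braid_mulV.
rewrite -[LHS]orbit_braid_mul1 -{1}wv orbit_braid_mulA.
by rewrite -(orbit_braid_mulA w v u) orbit_braid_mulV orbit_braid_mulg1.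
Qed.

HB.instance Definition _ := isGroup.Build orbit_braid_group orbit_braid_mulA
  orbit_braid_mul1 orbit_braid_mulg1 orbit_braid_mulV orbit_braid_mulgV.

End OrbitBraidGroup.

(* Exactness of 1 -> X -> Y -> Z -> 1 as maps; only the unit of Z is used. *)
Section ShortExact.

Definition short_exact_maps (X : Type) (Y Z : groupType) (f : X -> Y)
    (g : Y -> Z) :=
  [/\ injective f, range f = g @^-1` [set 1%g] & range g = [set: Z]].

Definition short_exact (X Y Z : groupType) (f : X -> Y) (g : Y -> Z) :=
  [/\ monoid.monoid_morphism f, monoid.monoid_morphism g & short_exact_maps f g].

End ShortExact.

Definition subset_incl (T : Type) (S S' : set T) (SS' : S `<=` S')
    (u : {u : T | u \in S}) : {u : T | u \in S'} :=
  exist _ (sval u) (mem_set (SS' _ (set_mem (svalP u)))).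

Section Subgroups.
Context (R : realType) (d : nat) (M : topologicalType).
Context (hM : topological_manifold R d M).
Context (G : finGroupType) (A : gaction G M) (n : nat) (x : 'I_n -> M).
Context (hx : orbit_conf A x) (hfree : forall i, free_type A (x i)).

Local Notation B := (orbit_braid_group hM hx hfree).
Local Notation path := (braid_path R A x).
Local Notation cls := (braid_class hM hx hfree).

Definition pure_orbit_braids : set B :=
  [set cls a | a in [set a : path | exists g, a 1 = tact A g x]].

Definition plain_braids : set B :=
  [set cls a | a in [set a : path | exists s, a 1 = permute x s]].

Definition pure_braids : set B :=
  [set cls a | a in [set a : path | a 1 = x]].

Lemma braid_subgroup_closed (P : pred (semidirect G n)) : P 1%g ->
  (forall u v, P u -> P v -> P (u * v)%g) -> (forall u, P u -> P u^-1%g) ->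
  group_closed (fun u : B =>
    u \in [set cls a | a in [set a : path | P (braid_end a)]]).
Proof.
move=> P1 PM PV; split=> [|u v].
  by rewrite unfold_in; apply/mem_set; exists (braid_one R hx) => //=; rewrite braid_end_one.
rewrite !unfold_in => /set_mem[a Pa <-] /set_mem[b Pb <-]; apply/mem_set.
exists (braid_mul a (braid_inv b)) => /=.
  by rewrite braid_end_mul// braid_end_inv//; apply: PM => //; exact: PV.
rewrite -(braid_class_mul hM hx hfree); congr (_ * _)%g.
apply: (mulIg (cls b)); rewrite mulVg; exact: braid_class_inv.
Qed.

Lemma pure_orbit_braids_closed : group_closed (fun u : B => u \in pure_orbit_braids).
Proof.
have -> : pure_orbit_braids =
    [set cls a | a in [set a : path | (braid_end a).2 == 1%g]].
  congr image; apply/seteqP; split=> a /=.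
    move=> [g ag]; rewrite (@braid_endE _ _ _ _ _ _ hx hfree a (g, 1%g)) //.
    by rewrite ag /twist permute1.
  by move=> /eqP e; exists (braid_end a).1; rewrite braid_endP /twist e permute1.
apply: (@braid_subgroup_closed (fun u => u.2 == 1%g)) => //= [[g s] [h t]|[g s]] /= /eqP ->.
  by rewrite mul1g.
by rewrite invg1.
Qed.

Lemma plain_braids_closed : group_closed (fun u : B => u \in plain_braids).
Proof.
have -> : plain_braids =
    [set cls a | a in [set a : path | (braid_end a).1 == 1%g]].
  congr image; apply/seteqP; split=> a /=.
    move=> [s as_]; rewrite (@braid_endE _ _ _ _ _ _ hx hfree a (1%g, s)) //.
    by rewrite as_ /twist tact1.
  by move=> /eqP e; exists (braid_end a).2; rewrite braid_endP /twist e tact1.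
apply: (@braid_subgroup_closed (fun u => u.1 == 1%g)) => //= [[g s] [h t]|[g s]] /= /eqP ->.
  move=> /eqP ->; apply/eqP/ffunP => i.
  by rewrite ffun_mulE !ffunE mulg1.
by apply/eqP/ffunP => i; rewrite ffunE ffun_invE !ffunE invg1.
Qed.

Lemma pure_braids_closed : group_closed (fun u : B => u \in pure_braids).
Proof.
have -> : pure_braids =
    [set cls a | a in [set a : path | braid_end a == 1%g]].
  congr image; apply/seteqP; split=> a /=.
    by move=> a1; apply/eqP/(braid_endE hx hfree); rewrite twist1.
  by move=> /eqP e; rewrite braid_endP e twist1.
apply: (@braid_subgroup_closed (fun u => u == 1%g)) => //= [u v|u] /eqP ->; first by rewrite mul1g.
by rewrite invg1.
Qed.

Definition pure_orbit_braid_group : Type := {u : B | u \in pure_orbit_braids}.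
HB.instance Definition _ := SubChoice.on pure_orbit_braid_group.
HB.instance Definition _ := SubChoice_isSubGroup.Build B
  (fun u => u \in pure_orbit_braids) pure_orbit_braid_group
  pure_orbit_braids_closed.

Definition braid_group : Type := {u : B | u \in plain_braids}.
HB.instance Definition _ := SubChoice.on braid_group.
HB.instance Definition _ := SubChoice_isSubGroup.Build B
  (fun u => u \in plain_braids) braid_group plain_braids_closed.

Definition pure_braid_group : Type := {u : B | u \in pure_braids}.
HB.instance Definition _ := SubChoice.on pure_braid_group.
HB.instance Definition _ := SubChoice_isSubGroup.Build B
  (fun u => u \in pure_braids) pure_braid_group pure_braids_closed.

Lemma pure_braids_sub_pure_orbit : pure_braids `<=` pure_orbit_braids.
Proof.
by move=> _ [a /= a1 <-]; exists a => //=; exists 1%g; rewrite a1 tact1.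
Qed.

Lemma pure_braids_sub_plain : pure_braids `<=` plain_braids.
Proof.
by move=> _ [a /= a1 <-]; exists a => //=; exists 1%g; rewrite a1 permute1.
Qed.

Definition incl_PPorb : pure_braid_group -> pure_orbit_braid_group :=
  subset_incl pure_braids_sub_pure_orbit.
Definition incl_PB : pure_braid_group -> braid_group :=
  subset_incl pure_braids_sub_plain.
Definition incl_PBorb : pure_braid_group -> B := sval.
Definition incl_PorbBorb : pure_orbit_braid_group -> B := sval.
Definition incl_BBorb : braid_group -> B := sval.

Lemma Phi_exists (u : B) :
  exists gs : semidirect G n, exists2 a : path, cls a = u & a 1 = twist A gs x.
Proof.
have [a au] := braid_class_surj u.
by exists (braid_end a), a => //; exact: braid_endP.
Qed.

(* Phi [alpha] = (g, s) where alpha(0) = x and alpha(1) = g x_s; the value does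
   not depend on alpha because the pair (g, s) is determined by the class
   (homot_end, twist_inj).  Phi_G and Phi_Sigma are analogous. *)
Definition Phi (u : B) : semidirect G n := sval (cid (Phi_exists u)).

Lemma Phi_G_exists (u : pure_orbit_braid_group) :
  exists g : {ffun 'I_n -> G}, exists2 a : path, cls a = sval u & a 1 = tact A g x.
Proof. by have [a [g ag] au] := set_mem (svalP u); exists g, a. Qed.

Definition Phi_G (u : pure_orbit_braid_group) : {ffun 'I_n -> G} :=
  sval (cid (Phi_G_exists u)).

Lemma Phi_Sigma_exists (u : braid_group) :
  exists s : 'S_n, exists2 a : path, cls a = sval u & a 1 = permute x s.
Proof. by have [a [s ag] au] := set_mem (svalP u); exists s, a. Qed.

Definition Phi_Sigma (u : braid_group) : 'S_n := sval (cid (Phi_Sigma_exists u)).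

End Subgroups.

Arguments pure_orbit_braid_group {R d M} hM {G A n x} hx hfree.
Arguments braid_group {R d M} hM {G A n x} hx hfree.
Arguments pure_braid_group {R d M} hM {G A n x} hx hfree.
Arguments incl_PPorb {R d M} hM {G A n x} hx hfree u.
Arguments incl_PB {R d M} hM {G A n x} hx hfree u.
Arguments incl_PBorb {R d M} hM {G A n x} hx hfree u.
Arguments incl_PorbBorb {R d M} hM {G A n x} hx hfree u.
Arguments incl_BBorb {R d M} hM {G A n x} hx hfree u.
Arguments Phi {R d M} hM {G A n x} hx hfree u.
Arguments Phi_G {R d M} hM {G A n x} hx hfree u.
Arguments Phi_Sigma {R d M} hM {G A n x} hx hfree u.
Arguments p_G {G n} u.
Arguments p_Sigma {G n} u.

(* Main.v *)
(* Since the pair (g, s) with alpha(1) = g x_s depends only on the class of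
   alpha, exactness at the first two places is read off the definitions; the
   content is the surjectivity of Phi.  A connected manifold of dimension at
   least 2 minus a finite set is path connected, so one point of a
   configuration can be moved at a time while avoiding the (finite) orbits of
   the others.  This joins y to g y coordinate by coordinate, and realizes each
   transposition by means of a parking point, hence joins y to g y_s. *)
Require Import Defs.
From mathcomp Require Import all_boot all_order all_algebra all_fingroup.
From mathcomp Require Import boolp classical_sets functions cardinality.
From mathcomp Require Import reals topology normedtype.
From mathcomp Require Import lra.

Import Order.TTheory GRing.Theory Num.Theory.
Import numFieldNormedType.Exports.

Local Open Scope classical_set_scope.

(** * Joining points by paths inside a subset *)

Section Joined.
Local Open Scope ring_scope.
Set Implicit Arguments.
Unset Strict Implicit.
Context (R : realType).

Definition joined (T : topologicalType) (D : set T) (p q : T) :=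
  exists f : R -> T, [/\ {within `[0, 1], continuous f},
    forall s, 0 <= s <= 1 -> D (f s), f 0 = p & f 1 = q].

Lemma joined_refl (T : topologicalType) (D : set T) p : D p -> joined D p p.
Proof.
move=> Dp; exists (fun=> p); split=> //.
by apply: continuous_subspaceT => ?; exact: cvg_cst.
Qed.

Lemma joined_sub (T : topologicalType) (D E : set T) p q :
  D `<=` E -> joined D p q -> joined E p q.
Proof. by move=> DE [f [cf fD f0 f1]]; exists f; split=> // s /fD/DE. Qed.

Lemma joined_sym (T : topologicalType) (D : set T) p q :
  joined D p q -> joined D q p.
Proof.
move=> [f [cf fD f0 f1]]; exists (f \o (fun s => 1 - s)); split.
- apply: (within_comp _ _ cf) => [|s /=].
    by apply: continuous_subspaceT; cts.
  by rewrite !in_itv /=; lra.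
- by move=> s s01; apply: fD; lra.
- by rewrite /= subr0.
- by rewrite /= subrr.
Qed.

Lemma joined_trans (T : topologicalType) (D : set T) p q r :
  joined D p q -> joined D q r -> joined D p r.
Proof.
move=> [f [cf fD f0 f1]] [g [cg gD g0 g1]].
exists (fun s => if s <= 2^-1 then f (2 * s) else g (2 * s - 1)); split.
- apply: (within_paste (u := id)); first exact: itv_closed.
  + by move=> ?.
  + apply: (@within_comp R R T _ [set` `[0, 1]] (fun s : R => 2 * s) f _ _ cf).
      by apply: continuous_subspaceT; cts.
    by move=> s; rewrite /= !in_itv /=; lra.
  + apply: (@within_comp R R T _ [set` `[0, 1]] (fun s : R => 2 * s - 1) g _ _ cg).
      by apply: continuous_subspaceT; cts.
    by move=> s; rewrite /= !in_itv /=; lra.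
  + by move=> s _ /= ->; rewrite divff ?pnatr_eq0// subrr f1.
- move=> s s01; case: (lerP s 2^-1) => hs; first by apply: fD; lra.
  by apply: gD; lra.
- by rewrite half0 mulr0.
- by rewrite half1 twice1.
Qed.

(** Continuity is asked only on a set [V] containing [D], so that this applies to the inverse of a
    chart, continuous only on the image of the chart. *)
Lemma joined_image (T U : topologicalType) (D : set T) (E : set U)
    (V : set T) (g : T -> U) p q :
  {within V, continuous g} -> D `<=` V -> (forall t, D t -> E (g t)) ->
  joined D p q -> joined E (g p) (g q).
Proof.
move=> cg DV DE [f [cf fD f0 f1]]; exists (g \o f); split.
- apply: (within_comp _ _ cg) => // s; rewrite /= in_itv /=.
  by move=> /fD/DV.
- by move=> s /fD/DE.
- by rewrite /= f0.
- by rewrite /= f1.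
Qed.

Lemma joined_segment d (D : set 'rV[R]_d) (a b : 'rV[R]_d) :
  (forall s, 0 <= s <= 1 -> D ((1 - s) *: a + s *: b)) -> joined D a b.
Proof.
move=> h; exists (fun s => (1 - s) *: a + s *: b); split=> //.
- apply: continuous_subspaceT => s.
  apply: cvgD; apply: cvgZr_tmp.
    by apply: ctsB; cts.
  exact: cts_id.
- by rewrite subr0 scale1r scale0r addr0.
- by rewrite subrr scale0r scale1r add0r.
Qed.

End Joined.

(** * Punctured balls in dimension at least 2 *)

Section PuncturedBall.
Local Open Scope ring_scope.
Set Implicit Arguments.
Unset Strict Implicit.
Context (R : realType) (d : nat).
Implicit Types (a b c : 'rV[R]_d) (r s : R).

(** Balls of row vectors are open cubes, for the sup distance. *)
Lemma rV_ballP c r a : ball c r a <-> 0 < r /\ forall i, `|c 0 i - a 0 i| < r.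
Proof.
split=> -[r0 h]; split=> // i; first exact: h.
by move=> j; rewrite (ord1 i); exact: h.
Qed.

Lemma convex_lt s (u v w : R) : 0 <= s <= 1 -> u < w -> v < w ->
  (1 - s) * u + s * v < w.
Proof.
(* The inequality is strict because [u < w] alone decides when [s = 0], and [s * (w - v)] is
   positive otherwise. *)
move=> /andP[]; rewrite le_eqVlt => /predU1P[<-|s0] s1 uw vw; first by lra.
have : 0 < s * (w - v) by rewrite mulr_gt0// subr_gt0.
have : 0 <= (1 - s) * (w - u) by rewrite mulr_ge0// subr_ge0// ltW.
by lra.
Qed.

Lemma rV_ball_segment c r a b s : 0 <= s <= 1 ->
  ball c r a -> ball c r b -> ball c r ((1 - s) *: a + s *: b).
Proof.
move=> s01 /rV_ballP[r0 ha] /rV_ballP[_ hb]; apply/rV_ballP; split=> // i.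
have /ltr_normlP[a1 a2] := ha i; have /ltr_normlP[b1 b2] := hb i.
rewrite !mxE; apply/ltr_normlP; have := convex_lt s01 a1 b1.
by have := convex_lt s01 a2 b2; split; lra.
Qed.

Lemma other_ord (hd : (2 <= d)%N) (i : 'I_d) : exists j : 'I_d, j != i.
Proof.
have : (0 < #|predC1 i|)%N by rewrite cardC1 card_ord -subn1 subn_gt0.
by move=> /card_gt0P[j]; rewrite inE => ji; exists j.
Qed.

(** These points serve as hubs: a path in the punctured ball goes straight to a hub, straight to
    another hub, then straight to its end. *)
Let axis c r j : 'rV[R]_d := c + (r / 2) *: delta_mx 0 j.

Lemma axisE c r j k : axis c r j 0 k = c 0 k + (r / 2) * (k == j)%:R.
Proof. by rewrite !mxE eqxx. Qed.

Lemma ball_axis c r j : 0 < r -> ball c r (axis c r j).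
Proof.
move=> r0; apply/rV_ballP; split=> // i; rewrite axisE.
by case: (i == j); apply/ltr_normlP; split; rewrite /=; lra.
Qed.

(** If [a] and [c] differ in coordinate [i], the segment from [a] to the hub of another coordinate
    misses [c]; that other coordinate exists since [2 <= d]. *)
Lemma joined_axis (hd : (2 <= d)%N) c r a : ball c r a -> a != c ->
  exists j, joined R (ball c r `\ c) a (axis c r j).
Proof.
move=> ba ac; have r0 : 0 < r by case/rV_ballP: ba.
have [i ai] : exists i, a 0 i != c 0 i.
  apply: contrapT => h; move/eqP: ac; apply; apply/rowP => i.
  by apply: contrapT => /eqP e; apply: h; exists i.
have [j ji] := other_ord hd i; exists j; apply: joined_segment => s s01.
split; first by apply: rV_ball_segment => //; exact: ball_axis.
(* The i-th coordinate differs from that of c until s = 1, where the j-th one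
   does. *)
move=> /rowP e; have := e i; have := e j.
rewrite ![in X in X -> _]mxE ![in X in _ -> X -> _]mxE !eqxx /=.
rewrite [i == j]eq_sym (negbTE ji) /= => e1 e2.
have : (1 - s) * (a 0 i - c 0 i) = 0 by lra.
move=> /eqP; rewrite mulf_eq0 !subr_eq0 (negbTE ai) orbF => /eqP s1.
by move: e1; rewrite -s1; lra.
Qed.

Lemma axis_joined c r j k : 0 < r ->
  joined R (ball c r `\ c) (axis c r j) (axis c r k).
Proof.
move=> r0; apply: joined_segment => s s01.
split; first by apply: rV_ball_segment => //; exact: ball_axis.
move=> /rowP e; have := e j; have := e k.
rewrite ![in X in X -> _]mxE ![in X in _ -> X -> _]mxE !eqxx /=.
(* If [j = k] the segment is constant; otherwise the offsets [s * (r / 2)] and [(1 - s) * (r / 2)]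
   along the two axes cannot both vanish. *)
rewrite [k == j]eq_sym; case: (j == k) => /= e1 e2; nra.
Qed.

Lemma punctured_ball_joined (hd : (2 <= d)%N) c r a b :
  (ball c r `\ c) a -> (ball c r `\ c) b ->
  joined R (ball c r `\ c) a b.
Proof.
move=> [ba /eqP ac] [bb /eqP bc]; have [j aj] := joined_axis hd ba ac.
have [k bk] := joined_axis hd bb bc.
apply: joined_trans aj _; apply: joined_trans _ (joined_sym bk).
by apply: axis_joined; case/rV_ballP: ba.
Qed.

Lemma punctured_ball_nonempty (hd : (2 <= d)%N) c r : 0 < r ->
  ball c r `\ c !=set0.
Proof.
move=> r0; pose j : 'I_d := Ordinal (ltnW hd).
exists (axis c r j); split; first exact: ball_axis.
by move=> /rowP/(_ j); rewrite axisE eqxx /=; lra.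
Qed.

End PuncturedBall.

(** * Complements of finite sets in a manifold *)

Section Manifold.
Set Implicit Arguments.
Unset Strict Implicit.
Context (R : realType) (d : nat) (hd : (2 <= d)%N) (M : topologicalType).
Context (hM : topological_manifold R d M).

(** [W] is the preimage of a small ball under a chart at [p]; the inverse chart carries over the
    paths of the ball and of the punctured ball. *)
Lemma punctured_nbhs_joined (p : M) (N : set M) : open N -> N p ->
  exists W : set M, [/\ open W, W p, W `<=` N & W `\ p !=set0] /\
    [/\ forall a b, W a -> W b -> joined R W a b
      & forall a b, (W `\ p) a -> (W `\ p) b -> joined R (W `\ p) a b].
Proof.
move=> oN Np.
have [U [V [f [g [[oU Up oV] [fUV fK cf cg]]]]]] := manifold_locally_euclidean hM p.
have gK v : V v -> U (g v) /\ f (g v) = v.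
  by rewrite -fUV => -[q Uq <-]; rewrite fK ?inE.
have fV q : U q -> V (f q) by move=> Uq; rewrite -fUV; exists q.
have gfp : g (f p) = p by rewrite fK ?inE.
have preim (S T : topologicalType) (k : S -> T) X Y : open X -> open Y ->
    {within X, continuous k} -> open (X `&` k @^-1` Y).
  by move=> oX oY; rewrite continuous_open_subspace// => /continuous_inP; exact.
have [r /= r0 rVN] : exists2 r : R, (0 < r)%R & ball (f p) r `<=` V `&` g @^-1` N.
  have /nbhs_ballP[r r0 h] : nbhs (f p) (V `&` g @^-1` N).
    apply: open_nbhs_nbhs; split; first exact: preim.
    by split; [exact: fV|rewrite /= gfp].
  by exists r.
have BV : ball (f p) r `<=` V by move=> v /rVN[].
set W := U `&` f @^-1` ball (f p) r.
(* [f] and [g] are mutually inverse between [W] and the ball, and between [W] without [p] and the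
   punctured ball. *)
have gW v : ball (f p) r v -> W (g v).
  by move=> bv; have [Ug fg] := gK _ (BV _ bv); split; rewrite //= fg.
have fW q : W q -> ball (f p) r (f q) /\ g (f q) = q.
  by move=> [Uq bq]; rewrite fK ?inE.
have gD v : (ball (f p) r `\ f p) v -> (W `\ p) (g v).
  move=> [bv vp]; split=> [|/= e]; first exact: gW.
  by apply: vp; have [_ /= <-] := gK _ (BV _ bv); rewrite e.
have fD q : (W `\ p) q -> (ball (f p) r `\ f p) (f q) /\ g (f q) = q.
  move=> [/fW[bq gfq] qp]; split=> //; split=> //= e.
  by apply: qp; rewrite /= -gfp -e gfq.
exists W; split; split.
- by apply: preim => //; exact: ball_open.
- by split=> //=; exact: ballxx.
- by move=> q [Uq /rVN[_]]; rewrite /= fK ?inE.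
- by have [v /gD] := punctured_ball_nonempty hd (f p) r0; exists (g v).
- move=> a b /fW[fa <-] /fW[fb <-].
  apply: (@joined_image R _ _ _ _ V g _ _ cg BV gW).
  by apply: joined_segment => s s01; exact: rV_ball_segment.
- move=> a b /fD[fa <-] /fD[fb <-].
  have DV : ball (f p) r `\ f p `<=` V by move=> v [/BV].
  exact: (@joined_image R _ _ _ _ V g _ _ cg DV gD (punctured_ball_joined hd fa fb)).
Qed.

(** Removing from [N] the points of [E] other than [p] leaves an open set, as finite sets are
    closed. A good neighbourhood inside it meets [E] at most in [p], so one of its two path
    properties applies according to whether [p] is in [E]. *)
Lemma nbhs_off_finite (E : set M) (p : M) (N : set M) : finite_set E ->
  open N -> N p -> exists W : set M, [/\ open W, W p, W `<=` N, W `\` E !=set0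
    & forall a b, (W `\` E) a -> (W `\` E) b -> joined R (~` E) a b].
Proof.
move=> fE oN Np.
have oN' : open (N `&` ~` (E `\ p)).
  apply: openI => //; rewrite openC.
  apply: (proj1 (@accessible_finite_set_closed M)).
    exact: hausdorff_accessible (manifold_hausdorff hM).
  exact: sub_finite_set fE.
have N'p : (N `&` ~` (E `\ p)) p by split=> //= -[_]; exact.
have [W [[oW Wp WN [q [Wq qp]]] [JW JWp]]] := punctured_nbhs_joined oN' N'p.
have WE a : W a -> E a -> a = p.
  by move=> /WN[_ h] Ea; apply: contrapT => ap; exact: h.
exists W; split=> //.
- by move=> a /WN[].
- by exists q; split=> // /(WE _ Wq).
- move=> a b [Wa Ea] [Wb Eb]; have [Ep|Ep] := pselect (E p).
    apply: (@joined_sub _ _ (W `\ p)) => [c [Wc cp] /(WE _ Wc)//|].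
    by apply: JWp; split=> // e; [apply: Ea|apply: Eb]; rewrite e.
  apply: (@joined_sub _ _ W) => [c Wc Ec|]; last exact: JW.
  by apply: Ep; rewrite -(WE _ Wc Ec).
Qed.

(** Connectedness is given for [M], not for the complement of [E]. Hence the clopen set is the
    closure in [M] of a path component; it is all of [M], so points of the component lie arbitrarily
    near [b]. *)
Lemma complement_finite_joined (hconn : connected [set: M]) (E : set M)
  (a b : M) : finite_set E -> ~ E a -> ~ E b -> joined R (~` E) a b.
Proof.
move=> fE Ea Eb.
(* The closure of the path component of a is open, even at the points of E. *)
pose C := closure [set c | ~ E c /\ joined R (~` E) a c].
have CT : C = [set: M].
  apply: hconn.
  - by exists a; apply: subset_closure; split=> //; exact: joined_refl.
  - exists C; last by rewrite setTI.
    rewrite openE => p Cp.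
    have [W [oW Wp _ _ JW]] := nbhs_off_finite fE openT (I : [set: M] p).
    have [q [[Eq aq] Wq]] := Cp W (open_nbhs_nbhs (conj oW Wp)).
    (* Every [p'] in [W] is a limit of points [c] of [W] off [E], and each of these is joined to
       [q], hence to [a]. *)
    apply: filterS (open_nbhs_nbhs (conj oW Wp)) => p' Wp' N nN.
    have oWN : open (W `&` N°) by apply: openI => //; exact: open_interior.
    have [W' [_ _ W'WN [c [W'c Ec]] _]] :=
      nbhs_off_finite fE oWN (conj Wp' nN).
    have [Wc /interior_subset Nc] := W'WN _ W'c.
    by exists c; split=> //; split=> //; apply: joined_trans aq _; exact: JW.
  - by exists C; [exact: closed_closure|rewrite setTI].
have Cb : C b by rewrite CT.
have [W [oW Wb _ _ JW]] := nbhs_off_finite fE openT (I : [set: M] b).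
have [q [[Eq aq] Wq]] := Cb W (open_nbhs_nbhs (conj oW Wb)).
by apply: joined_trans aq _; exact: JW.
Qed.

(** This supplies the parking point; [p] only witnesses that [M] is nonempty. *)
Lemma exists_off_finite (E : set M) (p : M) : finite_set E -> exists q, ~ E q.
Proof.
move=> fE; have [W [_ _ _ [q [_ Eq]] _]] := nbhs_off_finite fE openT (I : [set: M] p).
by exists q.
Qed.

End Manifold.

(** * Paths in the orbit configuration space *)

Section OrbitConfiguration.
Local Open Scope ring_scope.
Set Implicit Arguments.
Unset Strict Implicit.
Context (R : realType) (d : nat) (M : topologicalType).
Context (hM : topological_manifold R d M) (hd : (2 <= d)%N).
Context (hconn : connected [set: M]).
Context (G : finGroupType) (A : gaction G M) (n : nat).
Implicit Types (y z : 'I_n -> M) (i j k : 'I_n) (p q : M).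

Definition conf_joined y z := exists a : R -> 'I_n -> M,
  [/\ conf_path A a, a 0 = y & a 1 = z].

Lemma conf_joined_refl y : orbit_conf A y -> conf_joined y y.
Proof. by move=> fy; exists (fun=> y); split=> //; exact: conf_path_cst. Qed.

Lemma conf_joined_trans y z w :
  conf_joined y z -> conf_joined z w -> conf_joined y w.
Proof.
move=> [a [ca a0 a1]] [b [cb b0 b1]]; exists (concat a b); split.
- by apply: conf_path_concat => //; rewrite a1 b0.
- by rewrite concat0.
- by rewrite concat1.
Qed.

Definition update y i p : 'I_n -> M := fun k => if k == i then p else y k.

Lemma orbit_conf_update y i p : orbit_conf A y ->
  (forall j, j != i -> gorbit A p `&` gorbit A (y j) = set0) ->
  orbit_conf A (update y i p).
Proof.
move=> fy py j k; rewrite /update.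
have [ji|ji] := eqVneq j i; have [ki|ki] := eqVneq k i.
- by rewrite ji ki eqxx.
- by move=> _; exact: py.
- by move=> _; rewrite setIC; exact: py.
- exact: fy.
Qed.

(** The orbits of the other points form a finite set [E], and the moving point can travel in its
    complement. *)
Lemma conf_joined_update y i p : orbit_conf A y ->
  (forall j, j != i -> gorbit A p `&` gorbit A (y j) = set0) ->
  conf_joined y (update y i p).
Proof.
move=> fy py.
pose E := [set A gj.1 (y gj.2) | gj in [set gj : G * 'I_n | gj.2 != i]].
have fE : finite_set E by exact: finite_image.
have EP q : ~ E q <-> forall j, j != i -> gorbit A q `&` gorbit A (y j) = set0.
  split=> [Eq j ji|h [[g j] /= ji gq]].
    by apply/disjointP => g qg; apply: Eq; exists (g, j).
  by have /disjointP/(_ g) := h j ji; rewrite gq.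
have Ey : ~ E (y i) by apply/EP => j ji; apply: fy; rewrite eq_sym.
have [f [cf fD f0 f1]] := complement_finite_joined hd hM hconn fE Ey (proj2 (EP p) py).
exists (fun s => update y i (f s)); split.
- apply/conf_pathP; split=> [k|s s01].
    rewrite /update; case: (k == i) => //.
    by apply: continuous_subspaceT => ?; exact: cvg_cst.
  by apply: orbit_conf_update => //; apply/EP/fD.
- by apply/funext => k; rewrite /update f0; case: eqVneq => [->|].
- by rewrite f1.
Qed.

(** The points are moved one by one: in [z s] those with index in [s] have arrived. Each [z s] is
    the image of [y] under a tuple that is 1 outside [s], hence a configuration. *)
Lemma conf_joined_tact g y : orbit_conf A y -> conf_joined y (tact A g y).
Proof.
move=> fy; pose z (s : seq 'I_n) k := if k \in s then A (g k) (y k) else y k.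
have -> : tact A g y = z (enum 'I_n).
  by apply/funext => k; rewrite /z mem_enum.
have fz s : orbit_conf A (z s).
  have := orbit_conf_act [ffun k => if k \in s then g k else 1%g] 1%g fy.
  rewrite permute1; congr orbit_conf; apply/funext => k.
  by rewrite /z /tact ffunE; case: ifP => // _; exact: Defs.gact1.
elim: (enum 'I_n) => [|i s IHs]; first exact: conf_joined_refl.
apply: conf_joined_trans IHs _.
have -> : z (i :: s) = update (z s) i (A (g i) (y i)).
  by apply/funext => k; rewrite /z /update inE; case: eqVneq => [->|].
apply: conf_joined_update => // j ji; have := fz (i :: s) i j.
by rewrite /z !inE eqxx eq_sym (negbTE ji) /=; exact.
Qed.

(* The two points are exchanged by parking one of them at an unused point. *)
Lemma conf_joined_tperm i j y : orbit_conf A y ->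
  conf_joined y (permute y (tperm i j)).
Proof.
move=> fy; have [<-|ij] := eqVneq i j.
  by rewrite tperm1 permute1; exact: conf_joined_refl.
pose E := [set A gj.1 (y gj.2) | gj in [set: G * 'I_n]].
have fE : finite_set E by exact: finite_image.
have [p Ep] := exists_off_finite hd hM (y i) fE.
have py k : gorbit A p `&` gorbit A (y k) = set0.
  by apply/disjointP => g pg; apply: Ep; exists (g, k).
(* The point [i] goes to [p], the point [j] to the vacated [y i], and finally the point [i] from [p]
   to [y j]. *)
pose y1 := update y i p; pose y2 := update y1 j (y i).
have fy1 : orbit_conf A y1 by apply: orbit_conf_update => // k _; exact: py.
have y1i k : k != j -> gorbit A (y i) `&` gorbit A (y1 k) = set0.
  move=> _; rewrite /y1 /update; have [_|ki] := eqVneq k i.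
    by rewrite setIC; exact: py.
  by apply: fy; rewrite eq_sym.
have fy2 : orbit_conf A y2 by exact: orbit_conf_update.
apply: (conf_joined_trans (z := y1)).
  by apply: conf_joined_update => // k _; exact: py.
apply: (conf_joined_trans (z := y2)); first exact: conf_joined_update.
have -> : permute y (tperm i j) = update y2 i (y j).
  apply/funext => k; rewrite /permute /y2 /y1 /update.
  case: tpermP => [->|->|/eqP/negbTE -> /eqP/negbTE -> //]; rewrite eqxx //.
  by rewrite eq_sym (negbTE ij).
apply: conf_joined_update => // k ki; rewrite /y2 /y1 /update (negbTE ki).
by case: eqVneq => [_|kj]; apply: fy; rewrite eq_sym.
Qed.

(** A permutation is a product of transpositions. By [permuteM] the tail of the product acts first
    and its head last. *)
Lemma conf_joined_permute s y : orbit_conf A y -> conf_joined y (permute y s).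
Proof.
have [ts -> _] := prod_tpermP s; elim: ts => [|t ts IHts] in y *.
  by rewrite big_nil permute1; exact: conf_joined_refl.
move=> fy; rewrite big_cons -permuteM.
apply: conf_joined_trans (IHts y fy) _; apply: conf_joined_tperm.
by have := orbit_conf_act 1%g (\prod_(t <- ts) tperm t.1 t.2)%g fy; rewrite tact1.
Qed.

(** For [y = x] this reaches every endpoint allowed for an orbit braid, which gives the surjectivity
    of [Phi]. *)
Lemma conf_joined_twist u y : orbit_conf A y -> conf_joined y (twist A u y).
Proof.
move=> fy; apply: conf_joined_trans (conf_joined_permute u.2 fy) _.
apply: conf_joined_tact.
by have := orbit_conf_act 1%g u.2 fy; rewrite tact1.
Qed.

End OrbitConfiguration.

Lemma morph_monoid_morphism (X Y : groupType) (f : X -> Y) :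
  {morph f : u v / (u * v)%g} -> monoid.monoid_morphism f.
Proof. by move=> fM; split=> //; apply: (mulgI (f 1%g)); rewrite -fM !mulg1. Qed.

(** * The homomorphism [Phi] and the subgroups as preimages *)

Section OrbitBraids.
Set Implicit Arguments.
Unset Strict Implicit.
Context (R : realType) (d : nat) (M : topologicalType).
Context (hM : topological_manifold R d M) (hd : (2 <= d)%N).
Context (hconn : connected [set: M]).
Context (G : finGroupType) (A : gaction G M) (n : nat) (x : 'I_n -> M).
Context (hx : orbit_conf A x) (hfree : forall i, free_type A (x i)).

Local Notation B := (orbit_braid_group hM hx hfree).
Local Notation cls := (braid_class hM hx hfree).
Local Notation Phi := (Phi hM hx hfree).

(** [Phi] chooses a representative; any other one is homotopic to it with fixed endpoints, so it
    gives the same pair. *)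
Lemma Phi_class (a : braid_path R A x) : Phi (cls a) = braid_end a.
Proof.
rewrite /Defs.Phi; case: cid => u [b ba b1] /=.
rewrite -(braid_endE hx hfree b1); apply: homot_end => //.
exact/(braid_classP hM hx hfree).
Qed.

(** The product path ends at the twist of [x] by the product of the two pairs. *)
Lemma PhiM : {morph Phi : u v / (u * v)%g}.
Proof.
move=> u v; have [a <-] := braid_class_surj u; have [b <-] := braid_class_surj v.
have -> : (cls a * cls b)%g = cls (braid_mul a b) by exact: braid_class_mul.
by rewrite !Phi_class braid_end_mul.
Qed.

Lemma Phi_surj u : exists b : B, Phi b = u.
Proof.
have [a [ca a0 a1]] := conf_joined_twist hM hd hconn u hx.
exists (cls (BraidPath ca a0 (ex_intro _ u a1))).
by rewrite Phi_class; exact: braid_endE.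
Qed.

(** This and the next two lemmas give exactness at the middle terms: membership asks for some
    representative with a given kind of endpoint, and [Phi] reads the endpoint off any
    representative. *)
Lemma pure_orbit_braidsP (b : B) :
  pure_orbit_braids b <-> p_Sigma (Phi b) = 1%g.
Proof.
split=> [[a [g a1] <-]|].
  rewrite Phi_class (braid_endE hx hfree (u := (g, 1%g))) //.
  by rewrite a1 /twist permute1.
have [a <-] := braid_class_surj b; rewrite Phi_class => e.
exists a => //; exists (p_G (braid_end a)).
by rewrite braid_endP /twist [(braid_end a).2]e permute1.
Qed.

Lemma plain_braidsP (b : B) :
  plain_braids b <-> p_G (Phi b) = 1%g.
Proof.
split=> [[a [s a1] <-]|].
  rewrite Phi_class (braid_endE hx hfree (u := (1%g, s))) //.
  by rewrite a1 /twist tact1.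
have [a <-] := braid_class_surj b; rewrite Phi_class => e.
exists a => //; exists (p_Sigma (braid_end a)).
by rewrite braid_endP /twist [(braid_end a).1]e tact1.
Qed.

Lemma pure_braidsP (b : B) : pure_braids b <-> Phi b = 1%g.
Proof.
split=> [[a a1 <-]|].
  by rewrite Phi_class; apply: braid_endE => //; rewrite twist1.
have [a <-] := braid_class_surj b; rewrite Phi_class => e.
by exists a => //; rewrite /= braid_endP e twist1.
Qed.

(** [Phi_G] makes its own choice of representative; uniqueness of the pair reconciles it with
    [Phi]. *)
Lemma Phi_GE u : Phi_G hM hx hfree u = p_G (Phi (sval u)).
Proof.
rewrite /Phi_G; case: cid => g /= [a <- a1].
rewrite Phi_class (braid_endE hx hfree (u := (g, 1%g))) //.
by rewrite a1 /twist permute1.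
Qed.

Lemma Phi_SigmaE u : Phi_Sigma hM hx hfree u = p_Sigma (Phi (sval u)).
Proof.
rewrite /Phi_Sigma; case: cid => s /= [a <- a1].
rewrite Phi_class (braid_endE hx hfree (u := (1%g, s))) //.
by rewrite a1 /twist tact1.
Qed.

End OrbitBraids.

(** * Exactness of the five sequences and the diagram *)

(** The only obstruction to multiplicativity of [p_G] is the permutation of the second factor by the
    first; without it [Phi_G] is a homomorphism. *)
Lemma semidirect_p_GM (G : finGroupType) (n : nat) (u v : semidirect G n) :
  p_Sigma u = 1%g -> p_G (u * v)%g = (p_G u * p_G v)%g.
Proof.
move=> u1; apply/ffunP => i.
by rewrite ffun_mulE [RHS]ffun_mulE ffunE [u.2]u1 perm1.
Qed.

Lemma short_exact_mapsI (X : Type) (Y Z : groupType) (f : X -> Y) (g : Y -> Z) :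
  injective f -> (forall y, (exists u, f u = y) <-> g y = 1%g) ->
  (forall z, exists y, g y = z) -> short_exact_maps f g.
Proof.
move=> finj fg gsurj; split=> //; apply/seteqP; split=> //.
- by move=> _ [u _ <-]; apply/fg; exists u.
- by move=> y /= /fg[u <-]; exists u.
- by move=> z _; have [y <-] := gsurj z; exists y.
Qed.

Lemma sval_ex (T : Type) (S : set T) (y : T) :
  (exists u : {u | u \in S}, sval u = y) <-> S y.
Proof.
split=> [[[u Su] <-]|Sy]; first exact: set_mem Su.
by exists (exist _ y (mem_set Sy)).
Qed.

Lemma subset_incl_ex (T : Type) (S S' : set T) (SS' : S `<=` S')
    (y : {u | u \in S'}) : (exists u, subset_incl SS' u = y) <-> S (sval y).
Proof.
split=> [[u <-]|/sval_ex[u uy]]; first exact/set_mem/(svalP u).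
by exists u; exact: val_inj.
Qed.

Theorem theorem1p2 (R : realType) (d : nat) (M : topologicalType)
    (hM : topological_manifold R d M) (hd : (2 <= d)%N)
    (hconn : connected [set: M])
    (G : finGroupType) (A : gaction G M) (heff : effective A)
    (n : nat) (hn : (2 <= n)%N) (x : 'I_n -> M) (hx : orbit_conf A x)
    (hfree : forall i, free_type A (x i)) :
  [/\ short_exact (incl_PBorb hM hx hfree)
        (Phi hM hx hfree),
      short_exact (incl_PorbBorb hM hx hfree)
        (p_Sigma \o Phi hM hx hfree),
      short_exact_maps (incl_BBorb hM hx hfree)
        (p_G \o Phi hM hx hfree),
      short_exact (incl_PPorb hM hx hfree)
        (Phi_G hM hx hfree)
    & short_exact (incl_PB hM hx hfree)
        (Phi_Sigma hM hx hfree)] /\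
  [/\ incl_PorbBorb hM hx hfree
        \o incl_PPorb hM hx hfree
        = incl_PBorb hM hx hfree,
      incl_BBorb hM hx hfree
        \o incl_PB hM hx hfree
        = incl_PBorb hM hx hfree,
      p_G \o Phi hM hx hfree
        \o incl_PorbBorb hM hx hfree
        = Phi_G hM hx hfree
    & p_Sigma \o Phi hM hx hfree
        \o incl_BBorb hM hx hfree
        = Phi_Sigma hM hx hfree].
Proof.
have PhiM := @PhiM R d M hM G A n x hx hfree.
have Phi_surj := @Phi_surj R d M hM hd hconn G A n x hx hfree.
split; split.
- split; [| |apply: short_exact_mapsI].
  + exact: morph_monoid_morphism.
  + exact: morph_monoid_morphism.
  + exact: val_inj.
  + by move=> y; exact: iff_trans (sval_ex _ _) (pure_braidsP _).
  + exact: Phi_surj.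
- split; [| |apply: short_exact_mapsI].
  + exact: morph_monoid_morphism.
  + by apply: morph_monoid_morphism => u v /=; rewrite PhiM.
  + exact: val_inj.
  + by move=> y; exact: iff_trans (sval_ex _ _) (pure_orbit_braidsP _).
  + by move=> s; have [b bs] := Phi_surj (1%g, s); exists b; rewrite /= bs.
- apply: short_exact_mapsI.
  + exact: val_inj.
  + by move=> y; exact: iff_trans (sval_ex _ _) (plain_braidsP _).
  + by move=> g; have [b bs] := Phi_surj (g, 1%g); exists b; rewrite /= bs.
- split; [| |apply: short_exact_mapsI].
  + apply: morph_monoid_morphism => u v; exact: val_inj.
  + apply: morph_monoid_morphism => u v; rewrite !Phi_GE PhiM.
    by apply: semidirect_p_GM; exact/pure_orbit_braidsP/set_mem/(svalP u).
  + by move=> u v /(congr1 sval) uv; exact: val_inj.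
  + move=> y; rewrite Phi_GE.
    apply: iff_trans (subset_incl_ex _ _) (iff_trans (pure_braidsP _) _).
    (* The permutation part of [Phi] is already trivial on [y], so only the part in [G] remains to
       be tested. *)
    have /set_mem/pure_orbit_braidsP := svalP y.
    by case: Phi => g s /= ->; split=> [[]|->].
  (* A lift of [(g, 1)] has trivial permutation, so it lies in the subgroup. *)
  + move=> g; have [b bs] := Phi_surj (g, 1%g).
    have Pb : pure_orbit_braids b by apply/pure_orbit_braidsP; rewrite bs.
    by exists (exist _ b (mem_set Pb)); rewrite Phi_GE /= bs.
- split; [| |apply: short_exact_mapsI].
  + apply: morph_monoid_morphism => u v; exact: val_inj.
  + by apply: morph_monoid_morphism => u v; rewrite !Phi_SigmaE PhiM.
  + by move=> u v /(congr1 sval) uv; exact: val_inj.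
  + move=> y; rewrite Phi_SigmaE.
    apply: iff_trans (subset_incl_ex _ _) (iff_trans (pure_braidsP _) _).
    have /set_mem/plain_braidsP := svalP y.
    by case: Phi => g s /= ->; split=> [[]|->].
  + move=> s; have [b bs] := Phi_surj (1%g, s).
    have Pb : plain_braids b by apply/plain_braidsP; rewrite bs.
    by exists (exist _ b (mem_set Pb)); rewrite Phi_SigmaE /= bs.
- by [].
- by [].
- by apply/funext => u; rewrite Phi_GE.
- by apply/funext => u; rewrite Phi_SigmaE.
Qed.
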